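(* Let $\varrho$ be a control function and let $(X,d,\mu)$ be a quasiconvex uniform metric measure space satisfying $(S_{1,1}^\varrho)$. Then $[\Gamma]=0$ in $H_0^\varrho(\Gamma)$ for any quasi-lattice $\Gamma\subseteq X$.
   Context: A metric measure space $(X,d,\mu)$ is a metric space $(X,d)$ with a Borel regular outer measure $\mu$ such that $\mu(X)>0$ and $\mu(B(x,r))<\infty$ for all $x\in X$, $r>0$; $B(x,r)$ denotes the open ball. It is quasiconvex if there is $Q\ge 1$ such that any $x,y\in X$ are joined by a rectifiable path of length at most $Q\,d(x,y)$. It is uniform if there are non-decreasing functions $f,g\colon(0,\infty)\to(0,\infty)$ with $f(r)\le\mu(B(x,r))\le g(r)$ for all $x\in X$ and $0<r<\infty$. Upper gradients: a Borel function $g\colon X\to[0,\infty]$ is an upper gradient of $u$ if $|u(\gamma(a))-u(\gamma(b))|\le\int_\gamma g\,ds$ for every rectifiable path $\gamma\colon[a,b]\to X$, and a $1$-weak upper gradient if this holds for all rectifiable paths outside a family of $1$-modulus zero. $N^{1,1}(X,d,\mu)$ is the Newton-Sobolev space of (equivalence classes of) integrable functions $u\colon X\to[-\infty,\infty]$ having an integrable upper gradient, and $|\nabla u|$ is the minimal $1$-weak upper gradient of $u$. A control function is a non-decreasing $\varrho\colon[0,\infty)\to[0,\infty)$ with $\varrho(0)=1$ for which there are functions $L,M\colon(0,\infty)\to(0,\infty)$ with $\varrho(\varepsilon+t)\le L(\varepsilon)\varrho(t)$ and $\varrho(\varepsilon t)\le M(\varepsilon)\varrho(t)$ for all $t,\varepsilon>0$.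 $(X,d,\mu)$ satisfies $(S_{1,1}^\varrho)$ if there exist $C>0$ and $o\in X$ such that $\int_X|u|\,d\mu\le C\int_X|\nabla u|\,\varrho(d(o,\cdot))\,d\mu$ for every $u\in N^{1,1}(X,d,\mu)$ with bounded support. A quasi-lattice in $X$ is a set $\Gamma\subseteq X$ that is cobounded (there is $C>0$ with $\{x\in X: d(x,\Gamma)<C\}=X$) and uniformly locally finite (there is $N\colon(0,\infty)\to\mathbb N$ with $\#(\Gamma\cap B(x,r))\le N(r)$ for every ball $B(x,r)\subseteq X$). Controlled coarse homology: let $\Gamma$ be a quasi-lattice with basepoint $o\in\Gamma$. On $\Gamma^{q+1}$ use the max metric $d(\bar x,\bar y)=\max_i d(x_i,y_i)$ and $\bar o=(o,\dots,o)$. $C_q^\varrho(\Gamma)$ is the real vector space of functions $c\colon\Gamma^{q+1}\to\mathbb R$ such that: (a) there is $K(c)\ge0$ with $|c(\bar x)|\le K(c)\varrho(d(\bar x,\bar o))$ for all $\bar x$; (b) $c$ is alternating, $c(x_{\sigma(0)},\dots,x_{\sigma(q)})=\mathrm{sign}(\sigma)c(x_0,\dots,x_q)$ for all permutations $\sigma$; (c) there is $P(c)\ge0$ with $c(x_0,\dots,x_q)=0$ whenever $\max_{i\ne j}d(x_i,x_j)>P(c)$. This does not depend on the basepoint. Writing $c=\sum c(x_0,\dots,x_q)[x_0,\dots,x_q]$, the boundary $\partial_q\colon C_q^\varrho(\Gamma)\to C_{q-1}^\varrho(\Gamma)$ is the linear extension of $\partial_q[x_0,\dots,x_q]=\sum_{i=0}^q(-1)^i[x_0,\dots,\hat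 x_i,\dots,x_q]$ for $q\ge1$, and $\partial_0=0$; $H_q^\varrho(\Gamma)=\ker\partial_q/\mathrm{im}\,\partial_{q+1}$. The fundamental class $[\Gamma]\in H_0^\varrho(\Gamma)$ is the class of $\chi_\Gamma=\sum_{x\in\Gamma}[x]\in C_0^\varrho(\Gamma)$ (the constant function $1$ on $\Gamma$). *)

(* Defs.v *)
From HB Require Import structures.
From mathcomp Require Import all_boot all_order all_algebra.
From mathcomp Require Import all_fingroup.
From mathcomp Require Import all_classical all_reals all_analysis.
From mathcomp Require Import measurable_realfun.

Set Implicit Arguments.
Unset Strict Implicit.
Unset Printing Implicit Defensive.

Import Order.TTheory GRing.Theory Num.Theory.
Import numFieldNormedType.Exports.

Local Open Scope classical_set_scope.
Local Open Scope ring_scope.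

(* Measurable types are pointed in the library, so the metric spaces below carry
   a distinguished point. It is never referred to; a space of positive measure
   is nonempty, so nothing is lost. *)
#[short(type="pointedMetricType")]
HB.structure Definition PointedMetric (K : numDomainType) :=
  {M of Metric K M & Pointed M}.

Section Paths.
Context {R : realType} {X : pointedMetricType R}.

(* A path [pa, pb] -> X; the values of [pfun] outside [pa, pb] are junk. *)
Record metric_path : Type := MetricPath {
  pa : R;
  pb : R;
  pfun :> R -> X;
  path_le : pa <= pb;
  path_continuous : {within `[pa, pb], continuous pfun}
}.

Definition curve_length (f : R -> X) (a b : R) : \bar R :=
  ereal_sup [set (\sum_(0 <= i < size s)
      mdist (f (nth b (a :: s) i)) (f (nth b s i)))%:E
    | s in itv_partition a b].

Definition path_length (p : metric_path) : \bar R := curve_length p (pa p) (pb p).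

Definition rectifiable (p : metric_path) : Prop := (path_length p < +oo)%E.

(* Arc-length parametrization: the value at [s] is [p t] for any [t] such that
   the restriction of [p] to [pa p, t] has length [s]; for a rectifiable path and
   0 <= s <= path_length p such a [t] exists and [p t] does not depend on it. *)
Definition arc_length_param (p : metric_path) (s : R) : X :=
  p (xget (pa p)
    [set t | t \in `[pa p, pb p] /\ curve_length p (pa p) t = s%:E]).

Definition path_integral (p : metric_path) (g : X -> \bar R) : \bar R :=
  (\int[lebesgue_measure]_(s in `[0%R, fine (path_length p)])
     g (arc_length_param p s))%E.

Definition quasiconvex : Prop :=
  exists2 Q : R, 1 <= Q & forall x y : X, exists p : metric_path,
    [/\ p (pa p) = x, p (pb p) = y, rectifiable p &
        (path_length p <= (Q * mdist x y)%:E)%E].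

End Paths.

Arguments metric_path {R} X.
Arguments quasiconvex {R} X.

Section MetricMeasureSpaces.
Context {R : realType} {X : pointedMetricType R}.

Definition borel_set : set (set X) := <<s @open X >>.

Definition borel_regular (mu : {outer_measure set X -> \bar R}) : Prop :=
  borel_set `<=` mu.-caratheodory /\
  forall A : set X, exists B : set X, [/\ borel_set B, A `<=` B & mu B = mu A].

Definition metric_measure_space (mu : {outer_measure set X -> \bar R}) : Prop :=
  [/\ borel_regular mu, (0 < mu [set: X])%E &
      forall (x : X) (r : R), 0 < r -> (mu (ball x r) < +oo)%E].

Definition uniform_mms (mu : {outer_measure set X -> \bar R}) : Prop :=
  exists f g : R -> R,
    [/\ (forall r, 0 < r -> 0 < f r /\ 0 < g r),
        (forall r s, 0 < r -> r <= s -> f r <= f s /\ g r <= g s) &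
        forall (x : X) (r : R), 0 < r ->
          ((f r)%:E <= mu (ball x r))%E /\ (mu (ball x r) <= (g r)%:E)%E].

End MetricMeasureSpaces.

Section Sobolev.
Context {R : realType} {X : pointedMetricType R}.
Local Open Scope ereal_scope.

Definition borel_nonneg (g : X -> \bar R) : Prop :=
  measurable_fun [set: g_sigma_algebraType (@open X)]
    (g : g_sigma_algebraType (@open X) -> \bar R) /\
  forall x, 0 <= g x.

(* If [u] is infinite at an end point, the left-hand side is +oo, also when both
   values are the same infinity (in the library +oo - +oo and -oo - -oo equal
   -oo). Constant paths, for which the inequality reads 0 <= 0 when [u] is finite,
   are skipped so that this convention does not force [u] to be finite. *)
Definition upper_gradient_along (u g : X -> \bar R) (p : metric_path X) : Prop :=
  0 < path_length p ->
  `|u (p (pa p)) - u (p (pb p))| <= path_integral p g.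

Definition upper_gradient (u g : X -> \bar R) : Prop :=
  borel_nonneg g /\
  forall p : metric_path X, rectifiable p -> upper_gradient_along u g p.

Variable mu : {outer_measure set X -> \bar R}.

(* Integrals, integrability and null sets refer to the sigma-algebra of
   Caratheodory-measurable sets of the outer measure. *)
Local Notation muX :=
  ((mu : set (caratheodory_type mu) -> \bar R)
     : {measure set (caratheodory_type mu) -> \bar R}).

Definition modulus1 (F : set (metric_path X)) : \bar R :=
  ereal_inf [set \int[muX]_x h x
    | h in [set h : X -> \bar R | borel_nonneg h /\
        forall p, F p -> rectifiable p -> 1 <= path_integral p h]].

Definition weak_upper_gradient (u g : X -> \bar R) : Prop :=
  borel_nonneg g /\
  exists2 F : set (metric_path X), modulus1 F = 0 &
    forall p : metric_path X, rectifiable p -> ~ F p -> upper_gradient_along u g p.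

Definition minimal_weak_upper_gradient (u g : X -> \bar R) : Prop :=
  [/\ weak_upper_gradient u g, muX.-integrable setT g &
      forall h : X -> \bar R, weak_upper_gradient u h -> muX.-integrable setT h ->
        {ae muX, forall x, g x <= h x}].

(* N^{1,1} before passing to equivalence classes: the inequality stated below does
   not depend on the representative. *)
Definition newton_sobolev11 (u : X -> \bar R) : Prop :=
  muX.-integrable setT u /\ exists2 g, upper_gradient u g & muX.-integrable setT g.

Definition bounded_support (u : X -> \bar R) : Prop :=
  exists (x : X) (r : R), closure [set y | u y != 0] `<=` ball x r.

(* The minimal 1-weak upper gradient of [u] exists and is unique up to null sets
   for [u] in N^{1,1}. *)
Definition sobolev_inequality11 (rho : R -> R) : Prop :=
  exists2 C : R, (0 < C)%R & exists o : X,
    forall u : X -> \bar R, newton_sobolev11 u -> bounded_support u ->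
      exists2 g, minimal_weak_upper_gradient u g &
        \int[muX]_x `|u x| <=
        C%:E * \int[muX]_x (g x * (rho (mdist o x))%:E).

End Sobolev.

(* [rho] is a function on [0, +oo[; its values at negative reals are junk. *)
Definition control_function {R : realType} (rho : R -> R) : Prop :=
  [/\ (forall t, 0 <= t -> 0 <= rho t),
      (forall s t, 0 <= s -> s <= t -> rho s <= rho t),
      rho 0 = 1 &
      exists L M : R -> R,
        (forall e, 0 < e -> 0 < L e /\ 0 < M e) /\
        (forall t e, 0 < t -> 0 < e ->
           rho (e + t) <= L e * rho t /\ rho (e * t) <= M e * rho t)].

Section QuasiLattices.
Context {R : realType} {X : pointedMetricType R}.

Definition dist_to_set (x : X) (A : set X) : \bar R :=
  ereal_inf [set (mdist x y)%:E | y in A].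

Definition cobounded (G : set X) : Prop :=
  exists2 C : R, 0 < C & [set x : X | (dist_to_set x G < C%:E)%E] = setT.

Definition uniformly_locally_finite (G : set X) : Prop :=
  exists N : R -> nat, forall (x : X) (r : R), 0 < r ->
    (G `&` ball x r #<= `I_(N r))%card.

Definition quasi_lattice (G : set X) : Prop :=
  cobounded G /\ uniformly_locally_finite G.

End QuasiLattices.

Section CoarseHomology.
Context {R : realType} {X : pointedMetricType R} {G : set X}.
Variables (rho : R -> R) (o : G).

Local Notation simplex q := {ffun 'I_q.+1 -> G}.

Definition simplex_dist q (x y : simplex q) : R :=
  \big[Num.max/0]_(i < q.+1) mdist (\val (x i)) (\val (y i)).

Definition simplex_diam q (x : simplex q) : R :=
  \big[Num.max/0]_(ij : 'I_q.+1 * 'I_q.+1 | ij.1 != ij.2)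
    mdist (\val (x ij.1)) (\val (x ij.2)).

Definition chains q : set (simplex q -> R) := [set c |
  [/\ exists2 K : R, 0 <= K &
        forall x, `|c x| <= K * rho (simplex_dist x [ffun=> o]),
      (forall (s : 'S_q.+1) (x : simplex q),
         c [ffun i => x (s i)] = (-1) ^+ s * c x) &
      exists2 P : R, 0 <= P & forall x, P < simplex_diam x -> c x = 0]].
Arguments chains q : clear implicits.

Definition face q (k : 'I_q.+2) (x : simplex q.+1) : simplex q :=
  [ffun i => x (lift k i)].

(* The boundary map from degree q+1 to degree q: the coefficient at [y] of the
   linear extension of [x_0,...,x_{q+1}] |-> \sum_k (-1)^k [face k x]. The sum
   over simplices has finite support if G is locally finite and [c] is a chain. *)
Definition coarse_boundary q (c : simplex q.+1 -> R) : simplex q -> R := fun y =>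
  \sum_(x \in [set: simplex q.+1])
    c x * \sum_(k < q.+2) (-1) ^+ k * (face k x == y)%:R.

Definition cycles q : set (simplex q -> R) :=
  match q return set (simplex q -> R) with
  | 0 => chains 0
  | q'.+1 => [set c | chains q'.+1 c /\ coarse_boundary c = 0]
  end.
Arguments cycles q : clear implicits.

Definition homology_class q (c : simplex q -> R) : set (simplex q -> R) :=
  [set c + coarse_boundary b | b in chains q.+1].

Definition homology q : set (set (simplex q -> R)) :=
  [set homology_class c | c in cycles q].
Arguments homology q : clear implicits.

Definition fundamental_class : set (simplex 0 -> R) :=
  homology_class (q := 0) (fun=> 1).

Lemma fundamental_class_homology :
  control_function rho -> homology 0 fundamental_class.
Proof.
move=> [rho0 rho_nd rho01 _]; exists (fun=> 1) => //; split.
- exists 1 => // x; rewrite normr1 mul1r -rho01 rho_nd//.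
  exact: bigmax_ge_id.
- move=> s x; suff -> : s = 1%g by rewrite odd_perm1 expr0 mul1r.
  by apply/permP => i; rewrite !ord1.
- exists 0 => // x; rewrite /simplex_diam big_pred0 ?ltxx// => -[i j].
  by rewrite /= !ord1 eqxx.
Qed.

End CoarseHomology.

(* Main.v *)
(* By duality, a bounded flow out of every lattice point exists as soon as finite
   sets have large boundary, and the Sobolev inequality says exactly this.

   Let every ball of radius C meet G. For finite A in G put w = 3 - d(., A) / C and
   let u be w - 1 truncated to [0, 1]. Since w composed with a curve is
   1/C-Lipschitz in arc length, 1/C times the indicator of {1 <= w <= 2} is an
   upper gradient of u.
   Uniformity and the sparseness of G bound the integral of u below by a multiple
   of #A, and (S_{1,1}) bounds it above by the sum of rho(d(o, z)) over the points
   z of G outside A but within 3C of A.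

   Orient the graph joining points at distance < 3C and give an edge leaving x the
   capacity kappa * rho(d(o, x)). On a finite set A minimise the sum of
   (1 - inflow)^2 over all admissible flows: at the minimum, every edge from a
   smaller to a larger value of h = 1 - inflow is saturated (h = 0 off A), so the
   isoperimetric inequality applied to {h > 0}, and conservation applied to
   {h < 0}, force h = 0. A cluster point of these flows in the product topology
   has inflow 1 everywhere; its antisymmetrisation is a 1-chain with boundary the
   fundamental class. *)
Require Import Defs.
From HB Require Import structures.
From mathcomp Require Import all_boot all_order all_algebra.
From mathcomp Require Import all_fingroup.
From mathcomp Require Import all_classical all_reals all_analysis.
From mathcomp Require Import measurable_realfun.
From mathcomp Require Import ring lra.

Set Implicit Arguments.
Unset Strict Implicit.
Unset Printing Implicit Defensive.

Import Order.TTheory GRing.Theory Num.Theory.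
Import numFieldNormedType.Exports.

Local Open Scope classical_set_scope.
Local Open Scope ring_scope.

(** * Length of curves *)

Section CurveLength.
Context {R : realType} {X : pointedMetricType R}.
Implicit Types (f : R -> X) (a b c t : R) (s : seq R).

(** Recursion on the list with a moving starting point, so that partitions can be cut and
    concatenated by induction. *)
Fixpoint variation_along f a s : R :=
  if s is x :: s' then mdist (f a) (f x) + variation_along f x s' else 0.

Lemma variation_alongE f a b s : (\sum_(0 <= i < size s)
  mdist (f (nth b (a :: s) i)) (f (nth b s i))) = variation_along f a s.
Proof.
elim: s a => [|x s IH] a /=; first by rewrite big_geq.
by rewrite big_nat_recl//= IH.
Qed.

Lemma variation_along_cat f a s1 s2 : variation_along f a (s1 ++ s2) =
  variation_along f a s1 + variation_along f (last a s1) s2.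
Proof. by elim: s1 a => [|x s IH] a /=; rewrite ?add0r// IH addrA. Qed.

Lemma curve_lengthE f a b : curve_length f a b =
  ereal_sup [set (variation_along f a s)%:E | s in itv_partition a b].
Proof.
by congr ereal_sup; apply: eq_imagel => s _; rewrite variation_alongE.
Qed.

Lemma variation_le_curve_length f a b s : itv_partition a b s ->
  ((variation_along f a s)%:E <= curve_length f a b)%E.
Proof. by move=> abs; rewrite curve_lengthE; apply: ereal_sup_ubound; exists s. Qed.

Lemma curve_lengthxx f a : curve_length f a a = 0%E.
Proof.
rewrite curve_lengthE (_ : [set _ | _ in _] = [set 0%E]) ?ereal_sup1//.
apply/seteqP; split => [_ [s /itv_partitionxx -> <-]//|_ ->].
by exists [::] => //; split.
Qed.

Lemma mdist_le_curve_length f a b : a <= b ->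
  ((mdist (f a) (f b))%:E <= curve_length f a b)%E.
Proof.
rewrite le_eqVlt => /predU1P[->|ab]; first by rewrite mdistxx curve_lengthxx.
by have := variation_le_curve_length f (itv_partition1 ab); rewrite /= addr0.
Qed.

Lemma curve_length_ge0 f a b : a <= b -> (0 <= curve_length f a b)%E.
Proof.
by move=> ab; rewrite (le_trans _ (mdist_le_curve_length f ab))// lee_fin mdist_ge0.
Qed.

(** When the partition jumps over [b], inserting [b] does not decrease the variation, by the
    triangle inequality. *)
Lemma variation_split f a b c s : a <= b -> b <= c -> itv_partition a c s ->
  exists s1 s2, [/\ itv_partition a b s1, itv_partition b c s2 &
    variation_along f a s <= variation_along f a s1 + variation_along f b s2].
Proof.
move=> + bc; elim: s a => [|y s IH] a ab acs.
  have ac := itv_partition_nil acs.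
  have {ac} <- : a = b by apply/eqP; rewrite eq_le ab ac bc.
  by exists [::], [::]; split => //=; rewrite addr0.
have ay : a < y by case: acs => /= /andP[].
have ycs := itv_partition_cons acs.
move: ab; rewrite le_eqVlt => /predU1P[<-|ab].
  by exists [::], (y :: s); split => //=; rewrite add0r.
have [yb|by_] := leP y b.
  have [s1 [s2 [p1 p2 le12]]] := IH _ yb ycs.
  exists (y :: s1), s2; split => //=; last by rewrite -addrA lerD2l.
  by case: p1 => /= p1 l1; split => //=; rewrite ay.
exists [:: b], (y :: s); split; first exact: itv_partition1.
  by case: ycs => /= p l; split => //=; rewrite by_.
by rewrite /= addr0 addrA lerD2r metric_triangle.
Qed.

Lemma curve_length_add f a b c : a <= b -> b <= c ->
  curve_length f a c = (curve_length f a b + curve_length f b c)%E.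
Proof.
move=> ab bc; apply/eqP; rewrite eq_le; apply/andP; split.
  rewrite [leLHS]curve_lengthE; apply: ge_ereal_sup => _ [s acs <-].
  have [s1 [s2 [p1 p2]]] := variation_split f ab bc acs.
  rewrite -lee_fin => /le_trans; apply; rewrite EFinD.
  by apply: leeD; exact: variation_le_curve_length.
have [->|finac] := eqVneq (curve_length f a c) +oo%E; first by rewrite leey.
have {}finac : curve_length f a c \is a fin_num.
  by rewrite ge0_fin_numE ?ltey// curve_length_ge0// (le_trans ab).
have key s (t : seq R) : itv_partition a b s -> itv_partition b c t ->
    ((variation_along f a s)%:E + (variation_along f b t)%:E <=
     curve_length f a c)%E.
  move=> abs bct; rewrite -EFinD.
  have := variation_le_curve_length f (itv_partition_cat abs bct).
  by rewrite variation_along_cat; case: abs => _ /eqP ->.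
(* The suprema over partitions of the two halves are taken one after the other; each time a finite
   term is moved across the inequality, hence the reduction to finite length. *)
have Hab (t : seq R) : itv_partition b c t ->
    (curve_length f a b <= curve_length f a c - (variation_along f b t)%:E)%E.
  move=> bct; rewrite [leLHS]curve_lengthE; apply: ge_ereal_sup => _ [s abs <-].
  by rewrite leeBrDr//; exact: key.
have finab : curve_length f a b \is a fin_num.
  rewrite ge0_fin_numE ?curve_length_ge0//.
  have [t bct] : exists t : seq R, itv_partition b c t.
    move: bc; rewrite le_eqVlt => /predU1P[->|bc].
      by exists [::].
    by exists [:: c]; exact: itv_partition1.
  by rewrite (le_lt_trans (Hab _ bct))// -(fineK finac) -EFinB ltry.
rewrite addeC -leeBrDr//.
rewrite [leLHS]curve_lengthE; apply: ge_ereal_sup => _ [t bct <-].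
by rewrite leeBrDr// addeC -leeBrDr//; exact: Hab.
Qed.

Lemma within_continuous_mdist f a b t (e : R) : {within `[a, b], continuous f} ->
  t \in `[a, b] -> 0 < e -> exists2 d : R, 0 < d &
  forall u, u \in `[a, b] -> `|t - u| < d -> mdist (f t) (f u) < e.
Proof.
move=> /subspace_continuousP cf tab e0.
have /cf : `[a, b]%classic t by [].
move=> /(_ (ball (f t) e) (nbhsx_ballx _ _ e0)); rewrite /= withinE/=.
move=> /= [V /nbhs_ballP[d d0 dV] VE]; exists d => // u uab ut.
have : (V `&` `[a, b]) u by split => //; exact: dV.
by rewrite -VE => -[/=]; rewrite ballEmdist.
Qed.

(** * Continuity of arc length along a rectifiable curve *)

Section rectifiable_curve.
Variables (f : R -> X) (a b : R).
Hypotheses (ab : a <= b) (cf : {within `[a, b], continuous f}).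
Hypothesis finf : (curve_length f a b < +oo)%E.

Lemma curve_length_fin_num t u : a <= t -> t <= u -> u <= b ->
  curve_length f t u \is a fin_num.
Proof.
move=> at_ tu ub; rewrite ge0_fin_numE ?curve_length_ge0//.
apply: le_lt_trans finf; rewrite (curve_length_add f at_ (le_trans tu ub)).
rewrite (curve_length_add f tu ub) addeCA leeDl//.
by rewrite adde_ge0// curve_length_ge0// (le_trans ub).
Qed.

Let ell t := fine (curve_length f a t).

Lemma fine_curve_length_add t u : a <= t -> t <= u -> u <= b ->
  fine (curve_length f a u) =
  fine (curve_length f a t) + fine (curve_length f t u).
Proof.
move=> at_ tu ub; rewrite (curve_length_add f at_ tu) fineD//.
  by rewrite curve_length_fin_num// (le_trans tu).
exact: curve_length_fin_num.
Qed.

Lemma mdist_le_fine_curve_length t u : a <= t -> t <= u -> u <= b ->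
  mdist (f t) (f u) <= fine (curve_length f a u) - fine (curve_length f a t).
Proof.
move=> at_ tu ub; rewrite (fine_curve_length_add at_ tu ub) addrC addKr.
rewrite -lee_fin fineK ?curve_length_fin_num//.
exact: mdist_le_curve_length.
Qed.

Let ell_le t u : a <= t -> t <= u -> u <= b -> ell t <= ell u.
Proof.
move=> at_ tu ub; rewrite -subr_ge0.
by rewrite (le_trans _ (mdist_le_fine_curve_length at_ tu ub))// mdist_ge0.
Qed.

(** Take a partition of [[t, b]] whose variation is within [e / 2] of the length, and insert [t1] no
    later than its first point, with [f t1] within [e / 2] of [f t]. Then [[t1, b]] carries all but
    at most [e] of the length of [[t, b]], which leaves at most [e] for [[t, t1]]. *)
Let ell_right_continuous t (e : R) : a <= t -> t < b -> 0 < e ->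
  exists t1, [/\ t < t1, t1 <= b & ell t1 <= ell t + e].
Proof.
move=> at_ tb e0; have e20 : 0 < e / 2 by rewrite divr_gt0.
have tbfin := curve_length_fin_num at_ (ltW tb) (lexx b).
have [_ [s tbs <-]] := ub_ereal_sup_adherent e20 tbfin.
rewrite variation_alongE.
case: s tbs => [/itv_partition_nil tb'|y s tbs]; first by rewrite tb' ltxx in tb.
rewrite -/(curve_length _ _ _) => ineq.
have ty : t < y by case: tbs => /= /andP[].
have ybs := itv_partition_cons tbs; have yb := itv_partition_le ybs.
have tin : t \in `[a, b] by rewrite in_itv/= at_ ltW.
have [d d0 fd] := within_continuous_mdist cf tin e20.
pose t1 := t + Num.min (d / 2) (y - t).
have m0 : 0 < Num.min (d / 2) (y - t) by rewrite lt_min divr_gt0//= subr_gt0.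
have tt1 : t < t1 by rewrite ltrDl.
have t1y : t1 <= y by rewrite /t1 addrC -lerBrDr ge_min lexx orbT.
have t1b : t1 <= b by exact: le_trans yb.
exists t1; split => //.
have dt1 : mdist (f t) (f t1) < e / 2.
  apply: fd; first by rewrite in_itv/= t1b (le_trans at_ (ltW tt1)).
  rewrite distrC /t1 addrC addKr gtr0_norm//.
  by rewrite gt_min ltr_pdivrMr// mulr_natr mulr2n ltrDl d0.
have at1 : a <= t1 by exact: le_trans (ltW tt1).
have len1 : variation_along f t (y :: s) <=
    mdist (f t) (f t1) + fine (curve_length f t1 b).
  have lehs : mdist (f t1) (f y) + variation_along f y s <=
      fine (curve_length f t1 b).
    rewrite -lee_fin fineK ?curve_length_fin_num//.
    rewrite (curve_length_add f t1y yb) EFinD leeD//.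
      exact: mdist_le_curve_length.
    exact: variation_le_curve_length.
  rewrite /= (le_trans _ (lerD (lexx _) lehs))// addrA lerD2r.
  exact: metric_triangle.
have := fine_curve_length_add at_ (ltW tt1) t1b.
have := fine_curve_length_add (le_trans at_ (ltW tt1)) t1b (lexx b).
have := fine_curve_length_add at_ (ltW tb) (lexx b).
move: ineq; rewrite -(fineK tbfin) -EFinB lte_fin /ell => ineq.
move: len1 ineq.
lra.
Qed.

(** The same argument at the other end: [q] is the last partition point before [t], and [t1] is
    inserted between the two. *)
Let ell_left_continuous t (e : R) : a < t -> t <= b -> 0 < e ->
  exists t1, [/\ a <= t1, t1 < t & ell t <= ell t1 + e].
Proof.
move=> at_ tb e0; have e20 : 0 < e / 2 by rewrite divr_gt0.
have tfin := curve_length_fin_num (lexx a) (ltW at_) tb.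
have [_ [s ats <-]] := ub_ereal_sup_adherent e20 tfin.
rewrite variation_alongE.
case/lastP: s ats => [/itv_partition_nil tb'|s y ats].
  by rewrite tb' ltxx in at_.
rewrite -/(curve_length _ _ _) => ineq.
have [ay] : path <%R a (rcons s y) /\ last a (rcons s y) == t by case: ats.
rewrite last_rcons => /eqP yt; move: ay; rewrite {y}yt in ats ineq *.
rewrite rcons_path => /andP[pas]; set q := last a s => qt.
have aq : itv_partition a q s by split.
have aleq := itv_partition_le aq.
have tin : t \in `[a, b] by rewrite in_itv/= tb ltW.
have [d d0 fd] := within_continuous_mdist cf tin e20.
pose t1 := t - Num.min (d / 2) (t - q).
have m0 : 0 < Num.min (d / 2) (t - q) by rewrite lt_min divr_gt0//= subr_gt0.
have tt1 : t1 < t by rewrite /t1 ltrBlDr ltrDl.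
have qt1 : q <= t1 by rewrite /t1 lerBrDl -lerBrDr ge_min lexx orbT.
have at1 : a <= t1 by exact: le_trans qt1.
exists t1; split => //.
have dt1 : mdist (f t) (f t1) < e / 2.
  apply: fd; first by rewrite in_itv/= at1 (le_trans (ltW tt1)).
  rewrite /t1 opprB addrC subrK gtr0_norm//.
  by rewrite gt_min ltr_pdivrMr// mulr_natr mulr2n ltrDl d0.
move: ineq; rewrite -cats1 variation_along_cat /= addr0 -/q.
have t1b : t1 <= b by rewrite (le_trans (ltW tt1)).
have lehs : variation_along f a s + mdist (f q) (f t1) <= ell t1.
  rewrite -lee_fin fineK ?curve_length_fin_num//.
  rewrite (curve_length_add f aleq qt1) EFinD leeD//.
    exact: variation_le_curve_length.
  exact: mdist_le_curve_length.
rewrite -(fineK tfin) -EFinB lte_fin -/(ell t).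
have := metric_triangle (f q) (f t1) (f t); rewrite (metric_sym (f t1)).
move: lehs; lra.
Qed.

(** The supremum [m] of the times with length at most [s] has length exactly [s]: not more by left
    continuity, not less by right continuity. This is what makes the choice in [arc_length_param] a
    genuine one. *)
Lemma curve_length_surj (s : R) : 0 <= s -> s <= fine (curve_length f a b) ->
  exists2 t, t \in `[a, b] & curve_length f a t = s%:E.
Proof.
move=> s0 sb; pose T := [set t | a <= t <= b /\ ell t <= s].
have Ta : T a by split; rewrite ?lexx// /ell curve_lengthxx.
have ubT : ubound T b by move=> t [/andP[]].
have supT : has_sup T by split; [exists a|exists b].
pose m := sup T.
have am : a <= m by exact: (ub_le_sup supT.2).
have mb : m <= b by apply: ge_sup => //; exists a.
exists m; first by rewrite in_itv/= am.
rewrite -[LHS]fineK ?curve_length_fin_num//; congr EFin; apply/eqP.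
rewrite eq_le -/(ell m); apply/andP; split; rewrite leNgt; apply/negP => sm.
- have {}am : a < m.
    rewrite lt_neqAle am andbT; apply/eqP => ma.
    by move: sm; rewrite -ma /ell curve_lengthxx/= ltNge s0.
  have [|t1 [at1 t1m le1]] := ell_left_continuous am mb (e := (ell m - s) / 2).
    by rewrite divr_gt0// subr_gt0.
  have [t [/andP[_ tb] ts] t1t] : exists2 t, T t & t1 < t.
    have := sup_adherent (eps := m - t1) _ supT.
    rewrite subr_gt0 => /(_ t1m)[t Tt]; rewrite -/m subKr => ?; exists t => //.
  have := ell_le at1 (ltW t1t) tb; lra.
- have {}mb : m < b.
    by rewrite lt_neqAle mb andbT; apply/eqP => mb'; move: sm; rewrite mb' ltNge sb.
  have [|t1 [mt1 t1b le1]] := ell_right_continuous am mb (e := s - ell m).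
    by rewrite subr_gt0.
  have : t1 <= m.
    apply: (ub_le_sup supT.2); split; last lra.
    by rewrite t1b (le_trans am (ltW mt1)).
  by rewrite leNgt mt1.
Qed.

End rectifiable_curve.
End CurveLength.

(** * Upper gradients of truncated Lipschitz functions *)

Section UpperGradient.
Context {R : realType} {X : pointedMetricType R}.

(** * Level crossings of continuous real functions *)

Section crossing.
Implicit Types (f : R -> R) (a b v t : R).

Lemma level_set_compact f a b v : {within `[a, b], continuous f} ->
  compact (`[a, b] `&` f @^-1` [set v]).
Proof.
move=> cf; apply: (subclosed_compact _ (@segment_compact _ a b)) => //.
rewrite closed_setSI; last exact: interval_closed.
move/continuous_closedP : cf; apply.
exact/accessible_closed_set1/hausdorff_accessible/Rhausdorff.
Qed.

(** [t] is the least element of the compact level set; a value above [v] before [t] would yield an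
    earlier element by the intermediate value theorem. *)
Lemma first_hitting f a b v : {within `[a, b], continuous f} -> a <= b ->
  f a <= v -> v <= f b -> exists t, [/\ a <= t <= b, f t = v &
    forall u, a <= u -> u <= t -> f u <= v].
Proof.
move=> cf ab av vb.
have [|c cab fc] := IVT ab cf (v := v).
  by rewrite (min_idPl (le_trans av vb)) (max_idPr (le_trans av vb)) av.
have lev0 : `[a, b]%classic `&` f @^-1` [set v] !=set0 by exists c.
have cid : {within `[a, b]%classic `&` f @^-1` [set v], continuous (id : R -> R)}.
  by apply: continuous_subspaceT => x; exact: cvg_id.
have [t] := compact_EVT_min lev0 (level_set_compact cf) cid.
rewrite inE/= in_itv/= => -[/andP[at_ tb] ft] tmin.
exists t; rewrite at_ tb; split => // u au ut; rewrite leNgt; apply/negP => vu.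
have cfu : {within `[a, u], continuous f}.
  apply: continuous_subspaceW cf; apply: subset_itvl.
  by rewrite bnd_simp (le_trans ut).
have [|d] := IVT au cfu (v := v).
  by rewrite (min_idPl (le_trans av (ltW vu))) (max_idPr (le_trans av (ltW vu))) av ltW.
rewrite in_itv/= => /andP[ad du] fd.
have /tmin td : d \in `[a, b]%classic `&` f @^-1` [set v].
  by rewrite inE/= in_itv/= ad (le_trans du)// (le_trans ut).
have tu : t = u by apply/eqP; rewrite eq_le ut (le_trans td).
by move: vu; rewrite -tu ft ltxx.
Qed.

Lemma last_hitting f a b v : {within `[a, b], continuous f} -> a <= b ->
  f a <= v -> v <= f b -> exists t, [/\ a <= t <= b, f t = v &
    forall u, t <= u -> u <= b -> v <= f u].
Proof.
move=> cf ab av vb.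
have [|c cab fc] := IVT ab cf (v := v).
  by rewrite (min_idPl (le_trans av vb)) (max_idPr (le_trans av vb)) av.
have lev0 : `[a, b]%classic `&` f @^-1` [set v] !=set0 by exists c.
have cid : {within `[a, b]%classic `&` f @^-1` [set v], continuous (id : R -> R)}.
  by apply: continuous_subspaceT => x; exact: cvg_id.
have [t] := compact_EVT_max lev0 (level_set_compact cf) cid.
rewrite inE/= in_itv/= => -[/andP[at_ tb] ft] tmax.
exists t; rewrite at_ tb; split => // u tu ub; rewrite leNgt; apply/negP => uv.
have cfu : {within `[u, b], continuous f}.
  apply: continuous_subspaceW cf; apply: subset_itvr.
  by rewrite bnd_simp (le_trans at_).
have [|d] := IVT ub cfu (v := v).
  by rewrite (min_idPl (le_trans (ltW uv) vb)) (max_idPr (le_trans (ltW uv) vb)) vb ltW.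
rewrite in_itv/= => /andP[ud db] fd.
have /tmax dt : d \in `[a, b]%classic `&` f @^-1` [set v].
  by rewrite inE/= in_itv/= db (le_trans at_ (le_trans tu ud)).
have ut : u = t by apply/eqP; rewrite eq_le tu (le_trans ud).
by move: uv; rewrite ut ft ltxx.
Qed.

(** Stop at the first passage through [w], then go back to the last passage through [v] before
    it. *)
Lemma crossing f a b v w : {within `[a, b], continuous f} -> a <= b ->
  f a <= v -> v <= w -> w <= f b -> exists t u,
  [/\ a <= t, t <= u, u <= b, f t = v /\ f u = w &
      forall x, t <= x -> x <= u -> v <= f x <= w].
Proof.
move=> cf ab av vw wb.
have [u [/andP[au ub] fu uP]] := first_hitting cf ab (le_trans av vw) wb.
have cfu : {within `[a, u], continuous f}.
  by apply: continuous_subspaceW cf; apply: subset_itvl; rewrite bnd_simp.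
have vu : v <= f u by rewrite fu.
have [t [/andP[at_ tu] ft tP]] := last_hitting cfu au av vu.
exists t, u; split => // x tx xu; rewrite tP//= uP//.
exact: le_trans tx.
Qed.

End crossing.

Definition clip (lo hi x : R) : R := Num.max lo (Num.min hi x).

Lemma clipP (lo hi x : R) : lo <= hi ->
  [\/ x <= lo /\ clip lo hi x = lo, lo <= x <= hi /\ clip lo hi x = x |
      hi <= x /\ clip lo hi x = hi].
Proof.
move=> lohi; rewrite /clip; have [hx|xh] := leP hi x.
  by constructor 3; rewrite (max_idPr lohi).
have [lx|xl] := leP lo x; first by constructor 2; rewrite ?lx ltW.
by constructor 1; split=> //; exact: ltW.
Qed.

(** This reflection reduces downward crossings to upward ones. *)
Lemma clipN (lo hi x : R) : lo <= hi ->
  clip (- hi) (- lo) (- x) = - clip lo hi x.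
Proof.
move=> lohi; have lohi' : - hi <= - lo by rewrite lerN2.
by have [[? ->]|[/andP[? ?] ->]|[? ->]] := clipP x lohi;
  have [[? ->]|[/andP[? ?] ->]|[? ->]] := clipP (- x) lohi'; lra.
Qed.

(** Truncation ignores what [f] does beyond the two levels, so its whole increment is realised on a
    crossing between them. This is why the upper gradient below can be supported on the transition
    region alone. *)
Lemma clip_crossing (f : R -> R) (a b lo hi : R) : lo <= hi ->
  {within `[a, b], continuous f} -> a <= b ->
  clip lo hi (f a) != clip lo hi (f b) -> exists t u,
  [/\ a <= t, t <= u, u <= b,
      `|clip lo hi (f a) - clip lo hi (f b)| <= `|f t - f u| &
      forall x, t <= x -> x <= u -> lo <= f x <= hi].
Proof.
move=> lohi cf ab.
have main (g : R -> R) (m M : R) : m <= M -> {within `[a, b], continuous g} ->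
    clip m M (g a) < clip m M (g b) -> exists t u,
    [/\ a <= t, t <= u, u <= b,
      `|clip m M (g a) - clip m M (g b)| <= `|g t - g u| &
      forall x, t <= x -> x <= u -> m <= g x <= M].
  move=> mM cg lt_ab.
  have [ga gb ma bM] : [/\ g a <= clip m M (g a), clip m M (g b) <= g b,
      m <= clip m M (g a) & clip m M (g b) <= M].
    by move: lt_ab; have [[? ->]|[/andP[? ?] ->]|[? ->]] := clipP (g a) mM;
      have [[? ->]|[/andP[? ?] ->]|[? ->]] := clipP (g b) mM;
      split; lra.
  have [t [u [at_ tu ub [gt gu] gx]]] := crossing cg ab ga (ltW lt_ab) gb.
  exists t, u; split => // [|x tx xu]; first by rewrite gt gu.
  have /andP[h1 h2] := gx _ tx xu; by rewrite (le_trans ma h1) (le_trans h2 bM).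
have [ab'|ab'|->] := ltgtP (clip lo hi (f a)) (clip lo hi (f b)); last by rewrite ?eqxx.
  by move=> _; exact: main.
move=> _.
have := main (- f) (- hi) (- lo).
rewrite lerN2 => /(_ lohi) []; first by move=> x; apply: continuousN; exact: cf.
  by rewrite /= !(clipN _ lohi) ltrN2.
have distNN (x y : R) : `|- x - - y| = `|x - y| by rewrite -opprD normrN.
move=> t [u [at_ tu ub]]; rewrite !(clipN _ lohi) !distNN => le_tu tuP.
by exists t, u; split => // x tx xu; have := tuP _ tx xu; rewrite !lerN2 andbC.
Qed.

(** The integral of a nonnegative function is the supremum over the simple functions below it, so a
    pointwise comparison suffices. In path integrals this avoids the question whether the arc-length
    parametrization is measurable. *)
Lemma le_integral_nonneg d (T : measurableType d) (mu : {measure set T -> \bar R})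
    (f g : T -> \bar R) : (forall x, 0 <= f x)%E -> (forall x, f x <= g x)%E ->
  (\int[mu]_x f x <= \int[mu]_x g x)%E.
Proof.
move=> f0 fg; rewrite !ge0_integralTE//.
  by apply: le_ereal_sup => _ [h hf <-]; exists h => // x; exact: le_trans (fg x).
by move=> x; exact: le_trans (fg x).
Qed.

Lemma lipschitz_continuous (w : X -> R) (k : R) : 0 <= k ->
  (forall x y, `|w x - w y| <= k * mdist x y) -> continuous w.
Proof.
move=> k0 wk x; apply/(@cvgrPdist_lt _ R^o) => e e0; near=> y.
apply: le_lt_trans (wk x y) _.
(* Unlike [k], the factor [k + 1] is always positive and can be divided by. *)
apply: (@le_lt_trans _ _ ((k + 1) * mdist x y)).
  by rewrite ler_wpM2r ?mdist_ge0// lerDl.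
rewrite mulrC -ltr_pdivlMr; last by rewrite ltr_pwDr.
near: y; apply/nbhs_ballP; exists (e / (k + 1)) => /=.
  by rewrite divr_gt0// ltr_pwDr.
by rewrite ballEmdist.
Unshelve. all: end_near. Qed.

Lemma closed_borel (A : set X) : closed A -> borel_set A.
Proof.
move=> cA; rewrite -[A]setCK.
apply: (@measurableC _ (g_sigma_algebraType (@open X))).
by apply: sub_sigma_algebra; exact: closed_openC.
Qed.

Lemma arc_length_paramP (p : metric_path X) (s : R) : rectifiable p ->
  0 <= s <= fine (path_length p) -> exists t,
  [/\ pa p <= t, t <= pb p, arc_length_param p s = p t &
      curve_length p (pa p) t = s%:E].
Proof.
move=> rp /andP[s0 sL]; rewrite /arc_length_param; case: xgetP => [t _ []|].
  by rewrite in_itv/= => /andP[? ?] ?; exists t; split.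
have [t tp ts] := curve_length_surj (@Defs.path_le _ _ p) (@Defs.path_continuous _ _ p) rp s0 sL.
by move=> /(_ t) [].
Qed.

(** Along a crossing from [t] to [u], all arc-length parameters between [ell t] and [ell u] are sent
    into [S]. The path integral is therefore at least [k * (ell u - ell t)], which dominates
    [k * mdist (p t) (p u)] and hence the increment of the truncation. *)
Lemma clip_upper_gradient (w : X -> R) (k lo hi c : R) : 0 <= k -> lo <= hi ->
  (forall x y, `|w x - w y| <= k * mdist x y) ->
  upper_gradient (fun x => (clip lo hi (w x) - c)%:E)
    (fun x => (k * \1_[set x | lo <= w x <= hi] x)%:E).
Proof.
move=> k0 lohi wk; have cw := lipschitz_continuous k0 wk.
set S := [set x | _].
have borelS : borel_set S.
  apply: closed_borel; rewrite /S (_ : [set x | _] = w @^-1` `[lo, hi]).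
    by apply: preimage_closed => [x _|]; [exact: cw|exact: interval_closed].
  by apply/seteqP; split => x /=; rewrite in_itv.
split.
  split; last by move=> x; rewrite lee_fin mulr_ge0.
  apply/measurable_EFinP; exact: measurable_funM.
move=> p rp _.
have Lp := @Defs.path_le _ _ p; set a := pa p in Lp *; set b := pb p in Lp *.
rewrite -EFinB abse_EFin (_ : forall x y, x - c - (y - c) = x - y); last by move=> x y; ring.
have int0 : (0 <= path_integral p (fun x => (k * \1_S x)%:E))%E.
  by apply: integral_ge0 => s _; rewrite lee_fin mulr_ge0.
have [->|neq] := eqVneq (clip lo hi (w (p a))) (clip lo hi (w (p b))).
  by rewrite subrr normr0.
have cwp : {within `[a, b], continuous (w \o p)}.
  move=> x; apply: (@continuous_comp (subspace `[a, b]) _ _ p w x); last exact: cw.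
  exact: (@Defs.path_continuous _ _ p).
have [t [u [at_ tu ub le_tu tuS]]] := clip_crossing lohi cwp Lp neq.
pose ell x := fine (curve_length p a x).
have ellP x : a <= x -> x <= b -> curve_length p a x = (ell x)%:E.
  by move=> ax xb; rewrite fineK// (curve_length_fin_num rp).
have dell x y : a <= x -> x <= y -> y <= b -> mdist (p x) (p y) <= ell y - ell x.
  exact: (mdist_le_fine_curve_length rp).
have ellle x y : a <= x -> x <= y -> y <= b -> ell x <= ell y.
  by move=> ax xy yb; rewrite -subr_ge0 (le_trans _ (dell _ _ ax xy yb))// mdist_ge0.
have ell0 : ell a = 0 by rewrite /ell curve_lengthxx.
have au := le_trans at_ tu; have tb := le_trans tu ub.
(* The time [x] chosen for the parameter [s] may fall outside [[t, u]]; then the curve has length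
   zero between [x] and the nearer of [t] and [u], so it takes the same value at both. *)
have inS s : ell t <= s <= ell u -> S (arc_length_param p s).
  move=> /andP[ts su]; have [] := @arc_length_paramP p s rp.
    by rewrite (le_trans _ ts) -?ell0 ?ellle//= (le_trans su)// ellle.
  rewrite -/a -/b => x [ax xb -> ]; rewrite ellP// => -[xs].
  have [xt|tx] := ltP x t.
    have /mdist_positivity -> : mdist (p x) (p t) = 0; last exact: tuS.
    apply/eqP; rewrite eq_le mdist_ge0 andbT (le_trans (dell _ _ ax (ltW xt) tb))//.
    by rewrite subr_le0 xs.
  have [xu|ux] := leP x u; first exact: tuS.
  have /mdist_positivity <- : mdist (p u) (p x) = 0; last exact: tuS.
  apply/eqP; rewrite eq_le mdist_ge0 andbT (le_trans (dell _ _ au (ltW ux) xb))//.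
  by rewrite subr_le0 xs.
apply: (@le_trans _ _ (k%:E * lebesgue_measure `[ell t, ell u]%classic)%E).
  rewrite lebesgue_measure_itv/= lte_fin.
  have := dell _ _ at_ tu ub => duv.
  have : `|clip lo hi (w (p a)) - clip lo hi (w (p b))| <= k * (ell u - ell t).
    by rewrite (le_trans le_tu)// (le_trans (wk _ _))// ler_wpM2l.
  case: ltP => [_|ut]; first by rewrite -EFinD -EFinM lee_fin.
  rewrite mule0 lee_fin => /le_trans; apply.
  by rewrite mulr_ge0_le0// subr_le0.
rewrite /path_integral integral_mkcond.
have -> : (k%:E * lebesgue_measure `[ell t, ell u]%classic)%E =
    (\int[lebesgue_measure]_s (k * \1_`[ell t, ell u]%classic s)%:E)%E.
  under eq_integral do rewrite EFinM.
  rewrite ge0_integralZl_EFin//; last first.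
    by apply/measurable_EFinP; exact: measurable_indic.
  by rewrite integral_indic// setIT.
apply: le_integral_nonneg => s; first by rewrite lee_fin mulr_ge0.
have [stu|stu] := boolP (s \in `[ell t, ell u]%classic).
  have sin : ell t <= s <= ell u by move: stu; rewrite inE/= in_itv.
  rewrite patchE mem_set/=; last first.
    rewrite in_itv/=; case/andP: sin => ts su.
    by rewrite (le_trans _ ts) -?ell0 ?ellle//= (le_trans su)// ellle.
  by rewrite !indicE stu (mem_set (inS _ sin)).
rewrite indicE (negbTE stu) mulr0 patchE; case: ifP => // _.
by rewrite lee_fin mulr_ge0.
Qed.

End UpperGradient.

(** * The isoperimetric inequality *)

Section Isoperimetry.
Context {R : realType} {X : pointedMetricType R}.

(* Equal to 3 - d(x, s) / C when this is nonnegative; a maximum of finitely many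
   terms stands for the distance to [s]. *)
Definition proximity (C : R) (s : seq X) (x : X) : R :=
  \big[Num.max/0]_(a <- s) (3 - mdist x a / C).

Section proximity.
Variables (C : R) (C0 : 0 < C) (s : seq X).

(** Each term of the maximum is [C^-1]-Lipschitz; a one-sided estimate suffices by symmetry. *)
Lemma proximity_lipschitz x y :
  `|proximity C s x - proximity C s y| <= C^-1 * mdist x y.
Proof.
have half u v : proximity C s u <= proximity C s v + C^-1 * mdist u v.
  rewrite /proximity big_seq; apply: bigmax_le => [|a sa].
    rewrite addr_ge0 ?mulr_ge0 ?mdist_ge0 ?invr_ge0 ?(ltW C0)//.
    by rewrite big_seq; exact: bigmax_ge_id.
  apply: (@le_trans _ _ (3 - mdist v a / C + C^-1 * mdist u v)).
    have iC0 : 0 <= C^-1 by rewrite invr_ge0 ltW.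
    have := ler_wpM2l iC0 (metric_triangle v u a).
    by rewrite (metric_sym v u) ![_ / C]mulrC; lra.
  by rewrite lerD2r; apply: (le_bigmax_seq _ _ _ _ sa).
have := half x y; have := half y x; rewrite (metric_sym y x) ler_norml => ? ?.
by apply/andP; split; lra.
Qed.

Lemma proximity_ge1 x : 1 <= proximity C s x ->
  exists2 a, a \in s & mdist x a <= 2 * C.
Proof.
move=> w1; apply/hasP; apply/negPn/negP => /hasPn far.
suff : proximity C s x < 1 by rewrite ltNge w1.
rewrite /proximity big_seq; apply: bigmax_lt => // a /far.
rewrite -ltNge => xa; rewrite ltrBlDl -ltrBlDr.
by rewrite ltr_pdivlMr//; move: xa; lra.
Qed.

Lemma proximity_gt2 x a : a \in s -> mdist x a < C -> 2 < proximity C s x.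
Proof.
move=> sa xa; apply: lt_le_trans (le_bigmax_seq _ _ _ _ sa _) => //=.
by rewrite ltrBrDl -ltrBrDr ltr_pdivrMr//; move: xa; lra.
Qed.

End proximity.

Lemma mdist_continuous (x : X) : continuous (mdist x : X -> R).
Proof.
apply: (@lipschitz_continuous _ _ _ 1) => // y z.
have := metric_triangle x y z; have := metric_triangle x z y.
by rewrite (metric_sym z y) mul1r ler_norml => ? ?; apply/andP; split; lra.
Qed.

Section measure.
Variable mu : {outer_measure set X -> \bar R}.
Hypothesis mms : metric_measure_space mu.

Local Notation muX :=
  ((mu : set (caratheodory_type mu) -> \bar R)
     : {measure set (caratheodory_type mu) -> \bar R}).

(** Lets an upper gradient count as a weak one, with empty exceptional family; the infimum is
    attained at the zero function. *)
Lemma modulus1_set0 : modulus1 mu set0 = 0%E.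
Proof.
apply/eqP; rewrite eq_le; apply/andP; split.
  apply: ereal_inf_lbound; exists (fun=> 0%E); last exact: integral0.
  by split=> //; split=> //; exact: measurable_cst.
apply: le_ereal_inf_tmp => _ [h [[_ h0] _] <-].
exact: integral_ge0.
Qed.

Lemma caratheodory_borel (A : set X) : borel_set A -> mu.-caratheodory A.
Proof. by case: mms => -[+ _] _ _; apply. Qed.

Lemma borel_measurable_fun (f : X -> \bar R) :
  measurable_fun [set: g_sigma_algebraType (@open X)]
    (f : g_sigma_algebraType (@open X) -> \bar R) ->
  measurable_fun [set: caratheodory_type mu] (f : caratheodory_type mu -> \bar R).
Proof.
move=> mf _ B mB; have := mf measurableT B mB; rewrite !setTI.
exact: caratheodory_borel.
Qed.

Lemma continuous_borel (f : X -> R) : continuous f ->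
  measurable_fun [set: g_sigma_algebraType (@open X)]
    (f : g_sigma_algebraType (@open X) -> R).
Proof.
move=> cf; apply: (measurability (@RGenCInfty.G R)) => [|/= _ [_] [r] -> <-].
  exact: RGenCInfty.measurableE.
rewrite setTI; apply: closed_borel; apply: preimage_closed => [x _|].
  exact: cf.
exact: interval_closed.
Qed.

Lemma ball_borel (x : X) (r : R) : borel_set (ball x r).
Proof.
apply: sub_sigma_algebra; rewrite ballEmdist.
apply: (@open_comp _ _ (mdist x) [set t | t < r]); last exact: open_lt.
by move=> y _; exact: mdist_continuous.
Qed.

Lemma integrable_bounded (f : X -> R) (x : X) (r : R) : 0 < r ->
  measurable_fun [set: g_sigma_algebraType (@open X)]
    (f : g_sigma_algebraType (@open X) -> R) ->
  (forall y, `|f y| <= \1_(ball x r) y) ->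
  muX.-integrable setT (EFin \o f).
Proof.
move=> r0 mf fB; have mB := caratheodory_borel (ball_borel x r).
have mEf : measurable_fun [set: caratheodory_type mu] (EFin \o f).
  by apply: borel_measurable_fun; exact/measurable_EFinP.
have dominated := @le_integrable _ _ _ muX setT (@measurableT _ _) (EFin \o f)
  (fun y => (\1_(ball x r) y)%:E).
apply: (dominated mEf).
  by move=> y _ /=; rewrite lee_fin (le_trans (fB y))// ler_norm.
apply/integrableP; split.
  by apply/measurable_EFinP; exact: measurable_indic.
under eq_integral do rewrite /= ger0_norm//.
rewrite integral_indic// setIT.
by case: mms => _ _; apply.
Qed.

(** [o'] is the base point of the Sobolev inequality and [o] that of the lattice; [rho_shift] passes
    from one to the other, and to a point within [C], at the cost of the factor [K]. [m] and [M]
    bound the measure of balls of radius [C], and [N] will bound their multiplicity. *)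
Variables (C Cs K m M : R) (N : nat) (rho : R -> R) (o o' : X).
Hypotheses (C0 : 0 < C) (Cs0 : 0 < Cs).
Hypotheses (K0 : 0 <= K) (rho_ge0 : forall t : R, 0 <= t -> 0 <= rho t)
  (rho_nd : forall s t : R, 0 <= s -> s <= t -> rho s <= rho t)
  (rho_shift : forall x z, mdist x z < C -> rho (mdist o' x) <= K * rho (mdist o z)).
Hypothesis mu_ball : forall x, (m%:E <= mu (ball x C))%E /\ (mu (ball x C) <= M%:E)%E.
Hypothesis sobolev : forall u : X -> \bar R,
  newton_sobolev11 mu u -> bounded_support u ->
  exists2 g, minimal_weak_upper_gradient mu u g &
    (\int[muX]_x `|u x| <=
      Cs%:E * \int[muX]_x (g x * (rho (mdist o' x))%:E))%E.

Section cutoff.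
Variable s : seq X.
Hypothesis s_sparse : forall x, (count (fun a => (mdist x a < C)%R) s <= N)%N.

(** [u] equals 1 at distance less than [C] from [s] and vanishes beyond [2 * C]; [S] contains the
    region of transition. *)
Let w := proximity C s.
Let u x := clip 1 2 (w x) - 1.
Let S := [set x | 1 <= w x <= 2].
Let g x := C^-1 * \1_S x.

Let w_cont : continuous w.
Proof.
apply: (@lipschitz_continuous _ _ _ C^-1); first by rewrite invr_ge0 ltW.
exact: proximity_lipschitz.
Qed.

Let le12 : 1 <= 2 :> R. Proof. by rewrite ler1n. Qed.

Let u01 x : 0 <= u x <= 1.
Proof.
by rewrite /u; have [[? ->]|[/andP[? ?] ->]|[? ->]] := clipP (w x) le12; lra.
Qed.

Let u_neq0 x : u x != 0 -> 1 <= w x.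
Proof.
rewrite /u; have [[? ->]|[/andP[? ?] ->]|[? ->]] := clipP (w x) le12 => //.
  by rewrite subrr eqxx.
by move=> _; exact: le_trans le12 _.
Qed.

Let proximity_bounded : exists2 r, 0 < r & forall x, 1 <= w x -> ball o r x.
Proof.
(* The sum is a crude bound for the distance from [o] to any point of [s]; the final 1 makes the
   inequality strict, as an open ball requires. *)
exists (\sum_(a <- s) mdist o a + 2 * C + 1).
  by rewrite ltr_wpDl ?addr_ge0 ?sumr_ge0 ?mulr_ge0 ?(ltW C0)// => *; rewrite mdist_ge0.
move=> x /(proximity_ge1 C0)[a sa xa]; rewrite ballEmdist/=.
apply: le_lt_trans (metric_triangle o a x) _.
rewrite metric_sym; apply: (@le_lt_trans _ _ (\sum_(a <- s) mdist o a + 2 * C)).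
  rewrite (metric_sym a x) lerD// metric_sym (big_rem a sa)/= lerDl.
  by rewrite sumr_ge0// => *; rewrite mdist_ge0.
by rewrite ltrDl.
Qed.

Let borelS : borel_set S.
Proof.
apply: closed_borel; rewrite /S (_ : [set x | _] = w @^-1` `[1, 2]).
  by apply: preimage_closed => [x _|]; [exact: w_cont|exact: interval_closed].
by apply/seteqP; split => x /=; rewrite in_itv.
Qed.

Let upper_grad : upper_gradient (EFin \o u) (EFin \o g).
Proof.
apply: (@clip_upper_gradient _ _ w) => //; first by rewrite invr_ge0 ltW.
exact: proximity_lipschitz.
Qed.

Let u_measurable : measurable_fun [set: g_sigma_algebraType (@open X)]
  (u : g_sigma_algebraType (@open X) -> R).
Proof.
apply: measurable_funB => //; apply: measurable_maxr => //.
by apply: measurable_minr => //; exact: continuous_borel.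
Qed.

Let g_integrable : muX.-integrable setT (EFin \o g).
Proof.
have [r r0 wr] := proximity_bounded.
have -> : EFin \o g = (fun x => C^-1%:E * (\1_S x)%:E)%E by [].
apply: integrableZl => //; apply: (integrable_bounded (x := o) r0).
  exact: (@measurable_indic _ (g_sigma_algebraType (@open X))).
move=> y; rewrite ger0_norm// [X in X <= _]indicE.
have [|_] := boolP (y \in S); last by rewrite indicE ler0n.
by rewrite inE => -/andP[/wr yB _]; rewrite indicE (mem_set yB).
Qed.

Let u_newton : newton_sobolev11 mu (EFin \o u).
Proof.
split; last by exists (EFin \o g); [exact: upper_grad|exact: g_integrable].
have [r r0 wr] := proximity_bounded.
apply: (integrable_bounded (x := o) r0) => // y.
have /andP[u0 u1] := u01 y; rewrite ger0_norm//.
have [->|/u_neq0/wr yB] := eqVneq (u y) 0; first by rewrite indicE ler0n.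
by rewrite indicE (mem_set yB) u1.
Qed.

Let u_support : bounded_support (EFin \o u).
Proof.
have [r r0 wr] := proximity_bounded; exists o, r.
have cl : closed [set x | 1 <= w x].
  apply: (@preimage_closed _ _ w [set t | 1 <= t]); last exact: closed_ge.
  by move=> x _; exact: w_cont.
apply: subset_trans wr; rewrite [X in _ `<=` X](closure_id _).1//.
by apply: closure_subset => x /=; rewrite eqe; exact: u_neq0.
Qed.

(** The left-hand side counts the points of [s] within [C] of [x]. There are at most [N] of them,
    and as soon as there is one, [u x = 1]. *)
Let covering (x : X) : \sum_(a <- s) \1_(ball a C) x <= N%:R * u x.
Proof.
have -> : \sum_(a <- s) \1_(ball a C) x =
    (count (fun a => mdist x a < C)%R s)%:R :> R.
  rewrite -sum1_count natr_sum [RHS]big_mkcond/=; apply: eq_bigr => a _.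
  rewrite indicE (_ : (x \in (ball a C : set X)) = (mdist x a < C)); first by case: ifP.
  by apply/idP/idP; rewrite inE ballEmdist/= metric_sym.
have /andP[u0 u1] := u01 x.
have [has0|] := boolP (has (fun a => mdist x a < C)%R s); last first.
  by rewrite has_count -leqNgt leqn0 => /eqP ->; rewrite mulr_ge0.
have [a sa xa] := hasP has0; have w2 := proximity_gt2 C0 sa xa.
have -> : u x = 1.
  rewrite /u; have [[? _]|[/andP[? ?] _]|[_ ->]] := clipP (w x) le12;
    rewrite -/w in w2; lra.
by rewrite mulr1 ler_nat.
Qed.

(** Integrate [covering]: every ball contributes at least [m]. *)
Let u_lower : ((m *+ size s)%:E <= N%:R%:E * \int[muX]_x `|(u x)%:E|)%E.
Proof.
have mB a : measurable_fun [set: caratheodory_type mu]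
    (fun x : caratheodory_type mu => (\1_(ball a C) x)%:E : \bar R).
  apply/measurable_EFinP; apply: measurable_indic.
  exact: caratheodory_borel (ball_borel a C).
apply: (@le_trans _ _ (\int[muX]_x \sum_(a <- s) (\1_(ball a C) x)%:E)%E).
  rewrite ge0_integral_sum//.
  have -> : ((m *+ size s)%:E = \sum_(a <- s) m%:E)%E.
    elim: (s) => [|a t IH]; first by rewrite big_nil.
    by rewrite big_cons /= mulrS EFinD IH.
  apply: lee_sum => a _; rewrite integral_indic//.
    by rewrite setIT; case: (mu_ball a).
  exact: caratheodory_borel (ball_borel a C).
rewrite -ge0_integralZl//; last first.
  apply: measurableT_comp => //; apply: borel_measurable_fun.
  exact/measurable_EFinP.
apply: le_integral_nonneg => x; first by rewrite sume_ge0// => a _; rewrite lee_fin.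
rewrite sumEFin -EFinM lee_fin ger0_norm; first exact: covering.
by case/andP: (u01 x).
Qed.

Variable Z : seq X.
(** The balls of radius [C] around [Z] cover [S], which carries the gradient; [Z] plays the role of
    the outer boundary of [s]. *)
Hypothesis Z_boundary : forall x,
  (exists2 a, a \in s & mdist x a <= 2 * C) ->
  (forall a, a \in s -> C <= mdist x a) -> exists2 z, z \in Z & mdist x z < C.

Let g_weak : weak_upper_gradient mu (EFin \o u) (EFin \o g).
Proof.
case: upper_grad => g_borel g_along; split=> //.
by exists set0; [exact: modulus1_set0|move=> p rp _; exact: g_along].
Qed.

Let rho_measurable : measurable_fun [set: caratheodory_type mu]
  (fun x : caratheodory_type mu => (rho (mdist o' x))%:E : \bar R).
Proof.
apply: borel_measurable_fun; apply/measurable_EFinP.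
(* [rho] is monotone on nonnegative reals only, so its junk values are cut off before monotone
   functions are invoked for measurability. *)
have -> : (fun x : X => rho (mdist o' x)) = (fun t => rho (Num.max 0 t)) \o mdist o'.
  by apply/funext => x /=; rewrite (max_idPr (mdist_ge0 _ _)).
apply: (measurableT_comp _ (continuous_borel (@mdist_continuous o'))).
apply: nondecreasing_measurable => // t t' tt'.
have max0 (v : R) : 0 <= Num.max 0 v by rewrite le_max lexx.
by rewrite rho_nd// ge_max max0/= le_max tt' orbT.
Qed.

Let c z := C^-1 * K * rho (mdist o z).

Let c_ge0 z : 0 <= c z.
Proof. by rewrite !mulr_ge0 ?invr_ge0 ?(ltW C0)// rho_ge0 ?mdist_ge0. Qed.

(** [t] stands for the value at [x] of the minimal weak upper gradient, which is at most [g x]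
    almost everywhere. On [S] a single point of [Z] near [x] already pays for the weight, by
    [rho_shift]. *)
Let gradient_bound (x : X) (t : \bar R) : (0 <= t)%E -> (t <= (g x)%:E)%E ->
  (t * (rho (mdist o' x))%:E <=
   \sum_(z <- Z) ((c z)%:E * (\1_(ball z C) x)%:E))%E.
Proof.
move=> t0 tg; have sum_ge0 (r : seq X) :
    (0 <= \sum_(z <- r) ((c z)%:E * (\1_(ball z C) x)%:E))%E.
  by apply: sume_ge0 => z _; rewrite mule_ge0 ?lee_fin.
have [xS|xS] := boolP (x \in S); last first.
  have -> : t = 0%E.
    by apply/eqP; rewrite eq_le t0 andbT (le_trans tg)// /g indicE (negbTE xS) mulr0.
  by rewrite mul0e.
have /andP[w1 w2] : 1 <= w x <= 2 by move: xS; rewrite inE.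
have far a : a \in s -> C <= mdist x a.
  move=> sa; rewrite leNgt; apply/negP => /(proximity_gt2 C0 sa).
  by rewrite -/w ltNge w2.
have [z zZ xz] := Z_boundary (proximity_ge1 C0 w1) far.
rewrite (big_rem z zZ)/=; apply: le_trans (leeDl _ (sum_ge0 _)).
rewrite [\1__ x]indicE mem_set; last by rewrite ballEmdist/= metric_sym.
rewrite mule1; apply: (@le_trans _ _ ((C^-1)%:E * (rho (mdist o' x))%:E)%E).
  apply: lee_wpmul2r; first by rewrite lee_fin rho_ge0 ?mdist_ge0.
  by rewrite (le_trans tg)// lee_fin /g indicE xS mulr1.
rewrite -EFinM lee_fin /c -mulrA ler_wpM2l ?invr_ge0 ?(ltW C0)//.
exact: rho_shift.
Qed.

(** Minimality puts the gradient [h] of the Sobolev inequality below [g] almost everywhere;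
    integrating [gradient_bound] then costs at most [c z * M] for each [z] in [Z]. *)
Let u_upper : (\int[muX]_x `|(u x)%:E| <=
  (Cs * (C^-1 * K * M * \sum_(z <- Z) rho (mdist o z)))%:E)%E.
Proof.
have [h [[[h_meas h_ge0] _] h_int h_min] h_sobolev] := sobolev u_newton u_support.
apply: le_trans h_sobolev _; rewrite EFinM lee_pmul2l//.
have mB z := caratheodory_borel (ball_borel z C).
have mind z : measurable_fun [set: caratheodory_type mu]
    (fun x : caratheodory_type mu => (\1_(ball z C) x)%:E : \bar R)%E.
  by apply/measurable_EFinP; apply: measurable_indic; exact: mB.
apply: (@le_trans _ _
    (\int[muX]_x \sum_(z <- Z) ((c z)%:E * (\1_(ball z C) x)%:E))%E).
  apply: ae_ge0_le_integral => //.
  - by move=> x _; rewrite mule_ge0// lee_fin rho_ge0 ?mdist_ge0.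
  - apply: emeasurable_funM; last exact: rho_measurable.
    exact: borel_measurable_fun.
  - by move=> x _; apply: sume_ge0 => z _; rewrite mule_ge0 ?lee_fin.
  - by apply: emeasurable_sum => z; apply: measurable_funeM.
  - have [A [mA A0 subA]] := h_min _ g_weak g_integrable.
    exists A; split=> //; apply: subset_trans subA => x /=.
    by apply: contra_not => hx _; exact: gradient_bound.
rewrite ge0_integral_sum//; last 2 first.
- by move=> z; apply: measurable_funeM.
- by move=> z x _; rewrite mule_ge0 ?lee_fin.
rewrite mulr_sumr -sumEFin; apply: lee_sum => z _.
rewrite ge0_integralZl_EFin// integral_indic//; last exact: mB.
rewrite setIT (_ : C^-1 * K * M * rho (mdist o z) = c z * M); last first.
  by rewrite /c mulrAC.
rewrite [leRHS]EFinM; apply: lee_wpmul2l; first by rewrite lee_fin.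
by case: (mu_ball z).
Qed.

Lemma isoperimetric_cutoff : m * (size s)%:R <=
  N%:R * (Cs * (C^-1 * K * M * \sum_(z <- Z) rho (mdist o z))).
Proof.
rewrite mulr_natr -lee_fin; apply: le_trans u_lower _.
by rewrite EFinM; apply: lee_wpmul2l; [rewrite lee_fin|exact: u_upper].
Qed.

End cutoff.

End measure.
End Isoperimetry.

(** * Flows with bounded capacities *)

Section Flow.
Context {R : realType} {V : choiceType}.
Variables (nb : V -> seq V) (cap : V -> V -> R).
Hypotheses (nb_uniq : forall y, uniq (nb y))
  (nb_sym : forall x y, (x \in nb y) = (y \in nb x))
  (cap_ge0 : forall x y, 0 <= cap x y)
  (cap_nb : forall x y, x \notin nb y -> cap x y = 0).

(** Pointwise convergence makes [admissible] a product of segments, compact by Tychonoff's theorem,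
    and each [inflow] continuous, being a finite sum of coordinates. *)
Local Notation flow := {ptws V * V -> R}.

Definition inflow (f : flow) (y : V) : R :=
  \sum_(x <- nb y) (f (x, y) - f (y, x)).

Definition admissible : set flow :=
  [set f | forall p, f p \in `[0, cap p.1 p.2]].

Lemma admissible_compact : compact admissible.
Proof.
exact: (tychonoff (fun p : V * V => @segment_compact R 0 (cap p.1 p.2))).
Qed.

Lemma sum_delta (A : seq V) (F : V -> R) y : uniq A ->
  \sum_(v <- A) F v * (v == y)%:R = F y * (y \in A)%:R.
Proof.
elim: A => [|v A IH] /=; first by rewrite big_nil mulr0.
move=> /andP[vA uA]; rewrite big_cons IH// in_cons.
have [yv|yv] := eqVneq y v; last by rewrite mulr0 add0r.
by rewrite yv (negbTE vA) mulr0 addr0.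
Qed.

(** A discrete divergence theorem. An admissible flow vanishes off the edges, so the contributions
    from inside [B] form a full double sum over [B], which is antisymmetric and cancels. *)
Lemma sum_inflow (f : flow) (B : seq V) : uniq B -> admissible f ->
  \sum_(y <- B) inflow f y =
  \sum_(y <- B) \sum_(x <- nb y | x \notin B) (f (x, y) - f (y, x)).
Proof.
move=> uB fadm.
have f0 x y : x \notin nb y -> f (x, y) = 0.
  move=> /cap_nb xy; have := fadm (x, y); rewrite /= xy in_itv/=.
  by move=> ?; apply/eqP; rewrite eq_le andbC.
have inside y : \sum_(x <- nb y | x \in B) (f (x, y) - f (y, x)) =
    \sum_(x <- B) (f (x, y) - f (y, x)).
  rewrite (bigID (fun x => x \in nb y) (r := B))/= [X in _ + X]big1 ?addr0.
    rewrite -[LHS]big_filter -[RHS]big_filter; apply: perm_big.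
    apply: uniq_perm; rewrite ?filter_uniq// => x.
    by rewrite !mem_filter andbC.
  by move=> x xy; rewrite (f0 _ _ xy) f0 ?subrr// nb_sym.
rewrite /inflow.
under eq_bigr => y _ do rewrite (bigID (fun x => x \in B))/= inside.
rewrite big_split/= -[RHS]add0r; congr (_ + _).
under eq_bigr => y _ do rewrite sumrB.
by rewrite sumrB exchange_big/= subrr.
Qed.

Lemma inflow_continuous y : continuous (inflow ^~ y : flow -> R).
Proof.
have c (p : V * V) : continuous (fun f : flow => f p).
  exact: (@proj_continuous _ (fun _ : V * V => (R : topologicalType)) p).
apply: (continuous_big (@add_continuous R^o)) => x _ f.
by apply: (@continuousB _ R^o); exact: c.
Qed.

(** * Energy-minimising flows on a finite set *)

Section finite.
Variables (A : seq V) (uA : uniq A).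

Let energy (f : flow) : R := \sum_(y <- A) (1 - inflow f y) ^+ 2.

Let energy_continuous : continuous (energy : flow -> R).
Proof.
apply: (continuous_big (@add_continuous R^o)) => y _ f.
have c : {for f, continuous (fun g : flow => 1 - inflow g y)}.
  apply: (@continuousB _ R^o); first exact: cst_continuous.
  exact: inflow_continuous.
exact: (continuousM c c).
Qed.

(** Half the negative derivative of the energy with respect to the inflow at [y]; it is 0 off [A],
    where the energy does not see the inflow. *)
Let deficit f y : R := if y \in A then 1 - inflow f y else 0.

Let push (f : flow) (x y : V) (e : R) : flow :=
  fun p => f p + e * (p == (x, y))%:R.

Let inflow_push f x y e v : x \in nb y ->
  inflow (push f x y e) v = inflow f v + e * ((v == y)%:R - (v == x)%:R).
Proof.
move=> xy; have yx : y \in nb x by rewrite -nb_sym.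
rewrite /inflow /push mulrBr.
have -> : \sum_(u <- nb v) (f (u, v) + e * ((u, v) == (x, y))%:R -
    (f (v, u) + e * ((v, u) == (x, y))%:R)) =
    \sum_(u <- nb v) (f (u, v) - f (v, u)) +
    (\sum_(u <- nb v) (e * (v == y)%:R) * (u == x)%:R -
     \sum_(u <- nb v) (e * (v == x)%:R) * (u == y)%:R).
  rewrite -sumrB -big_split/=; apply: eq_bigr => u _.
  by rewrite !xpair_eqE -!mulnb !natrM; ring.
congr (_ + _); rewrite !sum_delta//; congr (_ - _).
  by have [->|_] := eqVneq v y; rewrite ?xy ?mulr1// !mulr0 mul0r.
by have [->|_] := eqVneq v x; rewrite ?yx ?mulr1// !mulr0 mul0r.
Qed.

(** Expand the squares: the linear term is the difference of deficits, and in the quadratic term at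
    most the two end points contribute, each [e ^+ 2]. *)
Let energy_push f x y e : x != y -> x \in nb y ->
  energy (push f x y e) <=
  energy f - 2 * e * (deficit f y - deficit f x) + 2 * e ^+ 2.
Proof.
move=> neq xy; rewrite /energy.
have deficitE v : deficit f v = (1 - inflow f v) * (v \in A)%:R.
  by rewrite /deficit; case: ifP; rewrite ?mulr1 ?mulr0.
pose D v : R := (v == y)%:R - (v == x)%:R.
have -> : \sum_(v <- A) (1 - inflow (push f x y e) v) ^+ 2 =
    energy f - 2 * e * \sum_(v <- A) (1 - inflow f v) * D v +
    e ^+ 2 * \sum_(v <- A) D v ^+ 2.
  rewrite /energy !mulr_sumr -sumrB -big_split/=; apply: eq_bigr => v _.
  by rewrite inflow_push// -/(D v); ring.
have -> : \sum_(v <- A) (1 - inflow f v) * D v = deficit f y - deficit f x.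
  under eq_bigr do rewrite mulrBr.
  by rewrite sumrB !sum_delta// !deficitE.
rewrite lerD2l mulrC ler_wpM2r ?sqr_ge0//.
have -> : \sum_(v <- A) D v ^+ 2 =
    \sum_(v <- A) 1 * (v == y)%:R + \sum_(v <- A) 1 * (v == x)%:R.
  rewrite -big_split/=; apply: eq_bigr => v _; rewrite /D !mul1r.
  have [->|] := eqVneq v y; last by rewrite sub0r sqrrN add0r => _; case: eqP; rewrite ?expr1n ?expr0n.
  by rewrite eq_sym (negbTE neq) subr0 expr1n addr0.
by rewrite !sum_delta// !mul1r (_ : 2 = 1 + 1)// lerD// lern1 leq_b1.
Qed.

Hypothesis isoperimetric : forall B, uniq B ->
  (size B)%:R <= \sum_(y <- B) \sum_(x <- nb y | x \notin B) cap x y.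

Lemma finite_flow : exists2 f, admissible f & forall y, y \in A -> inflow f y = 1.
Proof.
have adm0 : admissible !=set0.
  by exists (fun=> 0) => p; rewrite /= in_itv/= lexx cap_ge0.
have econt : {within admissible, continuous energy}.
  by apply: continuous_subspaceT => f; exact: energy_continuous.
have [f] := compact_EVT_min adm0 admissible_compact econt.
rewrite inE => fadm fmin; exists f => //.
have f_bnd x y : 0 <= f (x, y) <= cap x y.
  by have := fadm (x, y); rewrite /= in_itv.
(* at a minimum of the energy, no flow can be pushed towards a larger deficit *)
have no_push x y e : x \in nb y -> x != y -> 0 <= f (x, y) + e <= cap x y ->
    0 <= e ^+ 2 - e * (deficit f y - deficit f x).
  move=> xy neq fe.
  have /fmin : push f x y e \in admissible.
    rewrite inE => -[u v] /=; rewrite /push in_itv/=.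
    by have [[-> ->]|_] := eqVneq (u, v) (x, y); rewrite ?mulr1// mulr0 addr0 f_bnd.
  by have := energy_push f e neq xy; lra.
have saturated x y : x \in nb y -> deficit f x < deficit f y ->
    f (x, y) = cap x y /\ f (y, x) = 0.
  move=> xy lt_xy; have neq : x != y by apply/eqP => eq_xy; rewrite eq_xy ltxx in lt_xy.
  have yx : y \in nb x by rewrite -nb_sym.
  set d := deficit f y - deficit f x; have d0 : 0 < d by rewrite subr_gt0.
  have /andP[fxy0 fxy1] := f_bnd x y; have /andP[fyx0 fyx1] := f_bnd y x.
  split; apply/eqP; rewrite eq_le ?fxy1 ?fyx0 ?andbT/= leNgt; apply/negP => lt_f.
    (* The first bound keeps the flow admissible. The second gives [e < d], so that [e ^+ 2 - e * d]
       is negative, against [no_push]. *)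
    pose e := Num.min (cap x y - f (x, y)) (d / 2).
    have e0 : 0 < e by rewrite lt_min subr_gt0 lt_f divr_gt0.
    have ed : e <= d / 2 by rewrite ge_min lexx orbT.
    have ec : e <= cap x y - f (x, y) by rewrite ge_min lexx.
    have := no_push x y e xy neq; rewrite -/d.
    have -> : 0 <= f (x, y) + e <= cap x y by apply/andP; split; lra.
    move=> /(_ isT); have : 0 < e * (d - e) by rewrite mulr_gt0//; lra.
    by rewrite expr2 mulrBr; lra.
  (* Withdrawing [e] from the reverse edge has the same effect on the deficits. *)
  pose e := Num.min (f (y, x)) (d / 2).
  have e0 : 0 < e by rewrite lt_min lt_f divr_gt0.
  have ed : e <= d / 2 by rewrite ge_min lexx orbT.
  have ec : e <= f (y, x) by rewrite ge_min lexx.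
  have := no_push y x (- e) yx; rewrite eq_sym => /(_ neq).
  have -> : 0 <= f (y, x) - e <= cap y x by apply/andP; split; lra.
  move=> /(_ isT); rewrite sqrrN (_ : deficit f x - deficit f y = - d); last first.
    by rewrite opprB.
  rewrite mulrNN.
  have : 0 < e * (d - e) by rewrite mulr_gt0//; lra.
  by rewrite expr2 mulrBr; lra.
have deficit_le0 y : y \in A -> deficit f y <= 0.
  move=> yA; rewrite leNgt; apply/negP => y0.
  pose B := [seq v <- A | 0 < deficit f v].
  have uB : uniq B by rewrite filter_uniq.
  have yB : y \in B by rewrite mem_filter y0.
  have outB x : x \notin B -> deficit f x <= 0.
    rewrite mem_filter negb_and -leNgt => /orP[//|xA].
    by rewrite /deficit (negbTE xA).
  have : \sum_(v <- B) inflow f v =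
      \sum_(v <- B) \sum_(x <- nb v | x \notin B) cap x v.
    rewrite sum_inflow// [LHS]big_seq [RHS]big_seq; apply: eq_bigr => v.
    rewrite mem_filter => /andP[v0 vA].
    rewrite [LHS]big_seq_cond [RHS]big_seq_cond; apply: eq_bigr => x /andP[xv /outB x0].
    by have [-> ->] := saturated x v xv (le_lt_trans x0 v0); rewrite subr0.
  have := isoperimetric uB => le_cap eq_cap; rewrite -eq_cap in le_cap.
  have : 0 < \sum_(v <- B) deficit f v.
    rewrite (big_rem y yB)/= ltr_pwDl// big_seq sumr_ge0// => v /mem_rem.
    by rewrite mem_filter => /andP[/ltW].
  have -> : \sum_(v <- B) deficit f v = (size B)%:R - \sum_(v <- B) inflow f v.
    rewrite -sum1_size natr_sum -sumrB big_seq [RHS]big_seq; apply: eq_bigr => v.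
    by rewrite mem_filter /deficit => /andP[_ ->].
  by rewrite ltNge subr_le0 le_cap.
have deficit_ge0 y : y \in A -> 0 <= deficit f y.
  move=> yA; rewrite leNgt; apply/negP => y0.
  pose B := [seq v <- A | deficit f v < 0].
  have uB : uniq B by rewrite filter_uniq.
  have yB : y \in B by rewrite mem_filter y0.
  have outB x : x \notin B -> 0 <= deficit f x.
    rewrite mem_filter negb_and -leNgt => /orP[//|xA].
    by rewrite /deficit (negbTE xA).
  (* Here incoming edges are empty, so nothing enters [B], although negative deficit means an inflow
     above 1 at each of its vertices. *)
  have : \sum_(v <- B) inflow f v <= 0.
    rewrite sum_inflow// big_seq sumr_le0// => v.
    rewrite mem_filter => /andP[v0 vA].
    rewrite big_seq_cond sumr_le0// => x /andP[xv /outB x0].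
    have vx : v \in nb x by rewrite -nb_sym.
    have [-> ->] := saturated v x vx (lt_le_trans v0 x0).
    by rewrite sub0r oppr_le0.
  apply/negP; rewrite -ltNge.
  have pos v : v \in B -> 0 < inflow f v.
    by rewrite mem_filter /deficit => /andP[+ vA]; rewrite vA; lra.
  rewrite (big_rem y yB)/= ltr_pwDl ?pos// big_seq sumr_ge0// => v /mem_rem.
  by move/pos/ltW.
move=> y yA; have := deficit_le0 y yA; have := deficit_ge0 y yA.
by rewrite /deficit yA; lra.
Qed.

End finite.

(** The sets of admissible flows that solve the problem on a finite list generate a proper filter,
    by [finite_flow]. It clusters in the compact set [admissible], and the condition at each vertex
    is closed. *)
Lemma infinite_flow : (forall B, uniq B ->
    (size B)%:R <= \sum_(y <- B) \sum_(x <- nb y | x \notin B) cap x y) ->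
  exists f : V -> V -> R, (forall x y, 0 <= f x y <= cap x y) /\
    forall y, \sum_(x <- nb y) (f x y - f y x) = 1.
Proof.
move=> isoperimetric.
pose solutions (A : seq V) : set flow :=
  [set f | admissible f /\ forall y, y \in A -> inflow f y = 1].
pose F := filter_from [set: seq V] solutions.
have F_filter : Filter F.
  apply: filter_fromT_filter; first by exists [::].
  move=> A B; exists (A ++ B) => f [fadm fP].
  by split; split=> // y yA; apply: fP; rewrite mem_cat yA ?orbT.
have F_proper : ProperFilter F.
  apply: filter_from_proper => A _.
  have [f fadm fP] := finite_flow (undup_uniq A) isoperimetric.
  by exists f; split=> // y yA; apply: fP; rewrite mem_undup.
have F_adm : F admissible by exists [::] => // f [].
have [f [fadm f_cluster]] := admissible_compact F_proper F_adm.
exists (fun x y => f (x, y)); split=> [x y|y].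
  by have := fadm (x, y); rewrite /= in_itv.
have closed_y : closed [set g : flow | inflow g y = 1].
  apply: (@preimage_closed _ _ (inflow ^~ y) [set 1]).
    by move=> g _; exact: inflow_continuous.
  exact/accessible_closed_set1/hausdorff_accessible/Rhausdorff.
apply: closed_y => B fB; apply: f_cluster => //.
by exists [:: y] => // g [_]; apply; rewrite mem_head.
Qed.

End Flow.

(** * Coarse 1-chains *)

Section Lattice.
Context {R : realType} {X : pointedMetricType R} {G : set X}.

Lemma size_le_card (T : choiceType) (x0 : T) (S : set T) (n : nat) (t : seq T) :
  (S #<= `I_n)%card -> uniq t -> (forall x, x \in t -> S x) -> (size t <= n)%N.
Proof.
move=> Sn ut tS; rewrite -card_le_II.
have inj : {in `I_(size t) &, injective (nth x0 t)}.
  by move=> i j; rewrite !inE => it jt /eqP; rewrite nth_uniq// => /eqP.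
have /card_eqPle[_ le_t] := inj_card_eq inj.
apply: card_le_trans le_t _; apply: card_le_trans Sn.
by apply: subset_card_le => _ [i it <-]; apply/tS/mem_nth.
Qed.

Hypothesis ulf : uniformly_locally_finite G.

(** [fset_set] is empty on infinite sets; [mem_neighbours] excludes this case by local finiteness. A
    point counts among its own neighbours, but its loop adds zero to every net inflow. *)
Definition neighbours (P : R) (y : G) : seq G :=
  finmap.enum_fset (fset_set [set x : G | mdist (\val x) (\val y) < P]).

Lemma neighbours_uniq P y : uniq (neighbours P y).
Proof. exact: finmap.fset_uniq. Qed.

Lemma mem_neighbours P x y : 0 < P ->
  (x \in neighbours P y) = (mdist (\val x) (\val y) < P).
Proof.
move=> P0; rewrite [LHS]in_fset_set; last first.
  have [N GN] := ulf; have fin := card_le_finite (GN (\val y) P P0) (finite_II _).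
  have -> : [set x : G | mdist (\val x) (\val y) < P] =
      (fun x : G => \val x) @^-1` (G `&` ball (\val y) P).
    apply/seteqP; split => z /=; rewrite ballEmdist/= metric_sym; last by case.
    by move=> ?; split => //; exact: set_valP.
  by apply: finite_preimage fin => a b _ _; exact: val_inj.
by apply/idP/idP; rewrite inE.
Qed.

Lemma simplex1E (x z : {ffun 'I_2 -> G}) : (x == z) =
  (x ord0 == z ord0) && (x (lift ord0 ord0) == z (lift ord0 ord0)).
Proof.
apply/eqP/andP => [->//|[/eqP x0 /eqP x1]]; apply/ffunP => i.
by case: (unliftP ord0 i) => [j|] ->; rewrite ?ord1.
Qed.

Definition edge (a b : G) : {ffun 'I_2 -> G} :=
  [ffun i => if i == ord0 then a else b].

Lemma edge0 a b : edge a b ord0 = a.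
Proof. by rewrite ffunE eqxx. Qed.

Lemma edge1 a b : edge a b (lift ord0 ord0) = b.
Proof. by rewrite ffunE. Qed.

Lemma edgeK (x : {ffun 'I_2 -> G}) : edge (x ord0) (x (lift ord0 ord0)) = x.
Proof. by apply/eqP; rewrite simplex1E edge0 edge1 !eqxx. Qed.

Lemma fsum_seq (T : choiceType) (r : seq T) (F : T -> R) : uniq r ->
  (forall x, x \notin r -> F x = 0) ->
  \sum_(x \in [set: T]) F x = \sum_(x <- r) F x.
Proof.
move=> ur F0; rewrite [RHS]fsbig_seq//.
apply/esym/fsbig_widen => // x [_ /= /negP]; exact: F0.
Qed.

(** Deleting vertex 0 leaves the head with sign +, deleting vertex 1 leaves the tail with sign -.
    Only edges shorter than [P] ending or starting at [y] contribute, which makes the sum finite. *)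
Lemma coarse_boundaryE (P : R) (c : {ffun 'I_2 -> G} -> R) (y : {ffun 'I_1 -> G}) :
  0 < P ->
  (forall a b, P <= mdist (\val a) (\val b) -> c (edge a b) = 0) ->
  coarse_boundary c y = \sum_(z <- neighbours P (y ord0))
    (c (edge z (y ord0)) - c (edge (y ord0) z)).
Proof.
move=> P0 cP; rewrite /coarse_boundary.
pose i1 : 'I_2 := lift ord0 ord0.
pose heads := [seq edge z (y ord0) | z <- neighbours P (y ord0)].
pose tails := [seq edge (y ord0) z | z <- neighbours P (y ord0)].
have u_heads : uniq heads.
  rewrite map_inj_uniq ?neighbours_uniq// => a b /(congr1 (fun x : {ffun _} => x ord0)).
  by rewrite !edge0.
have u_tails : uniq tails.
  rewrite map_inj_uniq ?neighbours_uniq// => a b /(congr1 (fun x : {ffun _} => x i1)).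
  by rewrite !edge1.
pose F1 x : R := c x * (x i1 == y ord0)%:R.
pose F2 x : R := c x * (x ord0 == y ord0)%:R.
have face_eq k (x : {ffun 'I_2 -> G}) :
    (face k x == y) = (x (lift k ord0) == y ord0).
  apply/eqP/eqP => [<-|eq_xy]; first by rewrite ffunE.
  by apply/ffunP => i; rewrite ffunE ord1.
have F12 x : c x * \sum_(k < 2) (-1) ^+ k * (face k x == y)%:R = F1 x - F2 x.
  rewrite big_ord_recl big_ord1 !face_eq/= expr0 mul1r expr1 mulN1r.
  rewrite (_ : lift (lift ord0 ord0) ord0 = ord0); last exact: val_inj.
  by rewrite mulrBr.
have F1_0 x : x \notin heads -> F1 x = 0.
  move=> xh; rewrite /F1; have [xy|_] := eqVneq (x i1) (y ord0); last by rewrite mulr0.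
  rewrite -(edgeK x) cP ?mul0r// leNgt -mem_neighbours//.
  by apply: contra xh => xn; apply/mapP; exists (x ord0); rewrite -xy// edgeK.
have F2_0 x : x \notin tails -> F2 x = 0.
  move=> xh; rewrite /F2; have [xy|_] := eqVneq (x ord0) (y ord0); last by rewrite mulr0.
  rewrite -(edgeK x) cP ?mul0r// leNgt metric_sym -mem_neighbours//.
  by apply: contra xh => xn; apply/mapP; exists (x i1); rewrite -xy// edgeK.
(* A common finite list lets the sum of differences be split; each half is then shrunk to its own
   support. *)
pose r := undup (heads ++ tails).
have notr x : x \notin r -> (x \notin heads) && (x \notin tails).
  by rewrite mem_undup mem_cat negb_or.
rewrite (fsum_seq (undup_uniq (heads ++ tails))); last first.
  by move=> x /notr/andP[/F1_0 F1x /F2_0 F2x]; rewrite F12 F1x F2x subrr.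
under eq_bigr do rewrite F12.
rewrite sumrB -(fsum_seq (undup_uniq _)); last by move=> x /notr/andP[/F1_0].
rewrite -(fsum_seq (undup_uniq _)); last by move=> x /notr/andP[_ /F2_0].
rewrite (fsum_seq u_heads F1_0) (fsum_seq u_tails F2_0) !big_map -sumrB.
by apply: eq_bigr => z _; rewrite /F1 /F2 edge0 edge1 eqxx !mulr1.
Qed.

Variables (rho : R -> R) (o : G).

Lemma simplex_diam_edge a b : simplex_diam (edge a b) = mdist (\val a) (\val b).
Proof.
apply/eqP; rewrite eq_le; apply/andP; split.
  apply: bigmax_le => [|[i j] /= ij]; first exact: mdist_ge0.
  rewrite !ffunE; move: ij; case: (unliftP ord0 i) => [i'|] ->;
    case: (unliftP ord0 j) => [j'|] -> //=; rewrite ?ord1 ?eqxx//= => _.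
  by rewrite metric_sym.
have := @le_bigmax_cond _ R ('I_2 * 'I_2)%type 0 (ord0, lift ord0 ord0)
  (fun ij => ij.1 != ij.2)
  (fun ij => mdist (\val (edge a b ij.1)) (\val (edge a b ij.2))).
by rewrite /= edge0 edge1; apply.
Qed.

(** Allowing every larger [P'] lets two chains share one bound; adding 1 turns the strict condition
    on the diameter into a weak one. *)
Lemma chain_support (c : {ffun 'I_2 -> G} -> R) : chains rho o c ->
  exists2 P, 0 < P & forall P' a b, P <= P' ->
    P' <= mdist (\val a) (\val b) -> c (edge a b) = 0.
Proof.
move=> [_ _ [P P0 cP]]; exists (P + 1); first by rewrite ltr_wpDl.
move=> P' a b PP' P'ab; apply: cP; rewrite simplex_diam_edge.
by rewrite (lt_le_trans _ (le_trans PP' P'ab))// ltrDl.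
Qed.

Lemma chainsD (c d : {ffun 'I_2 -> G} -> R) : chains rho o c -> chains rho o d ->
  chains rho o (c + d).
Proof.
move=> [[K K0 cK] cs [P P0 cP]] [[K' K'0 dK] ds [P' P'0 dP]]; split.
- exists (K + K'); first exact: addr_ge0.
  move=> x; rewrite mulrDl; apply: le_trans (ler_normD _ _) _.
  by apply: lerD; [exact: cK|exact: dK].
- by move=> s x; rewrite /= !fctE cs ds mulrDr.
- exists (Num.max P P'); first by rewrite le_max P0.
  by move=> x; rewrite gt_max => /andP[/cP + /dP]; rewrite /= !fctE => -> ->; rewrite addr0.
Qed.

Lemma chainsN (c : {ffun 'I_2 -> G} -> R) : chains rho o c -> chains rho o (- c).
Proof.
move=> [[K K0 cK] cs [P P0 cP]]; split.
- by exists K => // x; rewrite normrN; exact: cK.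
- by move=> s x; rewrite /= !fctE cs mulrN.
- by exists P => // x /cP; rewrite /= !fctE => ->; rewrite oppr0.
Qed.

Lemma coarse_boundaryD (c d : {ffun 'I_2 -> G} -> R) :
  chains rho o c -> chains rho o d ->
  coarse_boundary (c + d) = coarse_boundary c + coarse_boundary d.
Proof.
move=> /chain_support[P P0 cP] /chain_support[P' P'0 dP].
have Q0 : 0 < Num.max P P' by rewrite lt_max P0.
have cQ a b : Num.max P P' <= mdist (\val a) (\val b) -> c (edge a b) = 0.
  by apply: cP; rewrite le_max lexx.
have dQ a b : Num.max P P' <= mdist (\val a) (\val b) -> d (edge a b) = 0.
  by apply: dP; rewrite le_max lexx orbT.
apply/funext => y; transitivity (coarse_boundary c y + coarse_boundary d y) => //.
rewrite (coarse_boundaryE _ Q0 cQ) (coarse_boundaryE _ Q0 dQ).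
rewrite (coarse_boundaryE _ Q0); last first.
  by move=> a b ab; rewrite fctE cQ// dQ// addr0.
by rewrite -big_split/=; apply: eq_bigr => z _; rewrite !fctE; ring.
Qed.

Lemma coarse_boundaryN (c : {ffun 'I_2 -> G} -> R) :
  chains rho o c -> coarse_boundary (- c) = - coarse_boundary c.
Proof.
move=> /chain_support[P P0 cP].
have cQ a b := cP P a b (lexx P).
apply/funext => y; transitivity (- coarse_boundary c y) => //.
rewrite (coarse_boundaryE _ P0 cQ) (coarse_boundaryE _ P0); last first.
  by move=> a b ab; rewrite fctE cQ// oppr0.
by rewrite -sumrN; apply: eq_bigr => z _; rewrite !fctE; ring.
Qed.

(** Both classes are cosets of the boundaries, and translation by [b] or [- b] carries one into the
    other. *)
Lemma fundamental_class_eq0 (b : {ffun 'I_2 -> G} -> R) : chains rho o b ->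
  coarse_boundary b = (fun=> 1) ->
  fundamental_class rho o = homology_class (q := 0) rho o 0.
Proof.
move=> b_chain b1; rewrite /fundamental_class /homology_class.
apply/seteqP; split => _ [c c_chain <-].
  exists (b + c); first exact: chainsD.
  by rewrite coarse_boundaryD// b1 add0r.
exists (- b + c); first by apply: chainsD => //; exact: chainsN.
rewrite coarse_boundaryD//; last exact: chainsN.
by rewrite coarse_boundaryN// b1 addrA subrr.
Qed.

Lemma antisymmetric_chain (h : G -> G -> R) (K P : R) :
  0 <= K -> 0 <= P ->
  (forall s t, 0 <= s -> s <= t -> rho s <= rho t) ->
  (forall a b, h b a = - h a b) ->
  (forall a b, `|h a b| <=
     K * (rho (mdist (\val o) (\val a)) + rho (mdist (\val o) (\val b)))) ->
  (forall a b, P < mdist (\val a) (\val b) -> h a b = 0) ->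
  chains rho o (fun x : {ffun 'I_2 -> G} => h (x ord0) (x (lift ord0 ord0))).
Proof.
move=> K0 P0 rho_nd hN hK hP; split.
(* Each end point is at distance at most [simplex_dist] from [o], so both weights are dominated. *)
- exists (K * 2); first by rewrite mulr_ge0.
  move=> x; rewrite (le_trans (hK _ _))// -mulrA ler_wpM2l// mulr_natl mulr2n.
  have le_dist i : mdist (\val o) (\val (x i)) <= simplex_dist x [ffun=> o].
    rewrite metric_sym.
    have := @le_bigmax_cond _ R 'I_2 0 i xpredT
      (fun i => mdist (\val (x i)) (\val ([ffun=> o] i))).
    by rewrite ffunE; apply.
  by apply: lerD; apply: rho_nd (mdist_ge0 _ _) (le_dist _).
- move=> s x; rewrite !ffunE; pose i1 : 'I_2 := lift ord0 ord0.
  have ord2P (i : 'I_2) : i = ord0 \/ i = i1.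
    by case: (unliftP ord0 i) => [j|] ->; [right; rewrite ord1|left].
  have s_neq : s ord0 != s i1 by rewrite (inj_eq perm_inj).
  have [s0|s0] := ord2P (s ord0); have [s1|s1] := ord2P (s i1);
    move: (s_neq); rewrite s0 s1 ?eqxx// => _.
  + suff -> : s = 1%g by rewrite odd_perm1 expr0 mul1r.
    by apply/permP => i; rewrite perm1; have [->|->] := ord2P i.
  + suff -> : s = tperm ord0 i1.
      by rewrite odd_tperm expr1 mulN1r hN.
    by apply/permP => i; have [->|->] := ord2P i; rewrite ?tpermL ?tpermR.
- exists P => // x; rewrite -{1}(edgeK x) simplex_diam_edge; exact: hP.
Qed.

End Lattice.

(** * Change of base point for the weight, and vanishing of the fundamental class *)

Lemma control_function_shift (R : realType) (rho : R -> R) (e : R) :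
  control_function rho -> 0 < e ->
  exists2 K : R, 0 <= K & forall s t : R, 0 <= t -> 0 <= s -> s <= e + t ->
    rho s <= K * rho t.
Proof.
move=> [rho_ge0 rho_nd rho0 [L [M [LM0 LM]]]] e0.
have [L0 _] := LM0 _ e0; have rhoe := rho_ge0 _ (ltW e0).
(* [L e] serves for [t > 0]. At [t = 0], which the condition on [L] does not cover, [rho 0 = 1] lets
   [rho e] take over. *)
exists (L e + rho e) => [|s t t0 s0 set]; first by rewrite addr_ge0// ltW.
apply: le_trans (rho_nd _ _ s0 set) _; rewrite mulrDl.
have [t_eq0|t_neq0] := eqVneq t 0.
  by rewrite t_eq0 addr0 rho0 !mulr1 lerDr ltW.
have t_gt0 : 0 < t by rewrite lt_neqAle eq_sym t_neq0.
by rewrite (le_trans (LM _ _ t_gt0 e0).1)// lerDl mulr_ge0// rho_ge0.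
Qed.

Theorem theoremB (R : realType) (rho : R -> R) (X : pointedMetricType R)
    (mu : {outer_measure set X -> \bar R})
    (rho_control : control_function rho)
    (X_mms : metric_measure_space mu)
    (X_quasiconvex : quasiconvex X)
    (X_uniform : uniform_mms mu)
    (X_sobolev : sobolev_inequality11 mu rho)
    (G : set X) (G_quasi_lattice : quasi_lattice G) (o : G) :
  fundamental_class rho o = homology_class (q := 0) rho o 0.
Proof.
have [rho_ge0 rho_nd _ _] := rho_control.
have [fu [gu [fg_pos _ fg_ball]]] := X_uniform.
have [Cs Cs0 [x0 sob]] := X_sobolev.
have [[C C0 cob] ulf] := G_quasi_lattice.
have [N GN] := ulf.
have near_G x : exists z : G, mdist x (\val z) < C.
  have : [set x : X | (dist_to_set x G < C%:E)%E] x by rewrite cob.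
  move=> /ereal_inf_lt[_ [y Gy <-]]; rewrite lte_fin => xy.
  by exists (exist _ y (mem_set Gy)).
(* The shift accounts both for moving the base point from [x0] to [o] and for moving [x] to a point
   within [C]. *)
have E0 : 0 < mdist x0 (\val o) + C by rewrite ltr_wpDl ?mdist_ge0.
have [K K0 rhoK] := control_function_shift rho_control E0.
have rho_shift x z : mdist x z < C ->
    rho (mdist x0 x) <= K * rho (mdist (\val o) z).
  move=> xz; apply: rhoK; rewrite ?mdist_ge0//.
  have := metric_triangle x0 (\val o) x; have := metric_triangle (\val o) z x.
  by rewrite (metric_sym z x); lra.
have [fC0 gC0] := fg_pos _ C0.
(* A point of the transition region is within [2 * C] of the finite set and within [C] of some
   lattice point, which is then a neighbour at scale [3 * C]. *)
pose P := 3 * C; have P0 : 0 < P by rewrite mulr_gt0.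
(* The constant of [isoperimetric_cutoff] divided by the lower bound [fu C] for the measure of
   balls. *)
pose kappa := (N C)%:R * (Cs * (C^-1 * K * gu C)) / fu C.
have kappa0 : 0 <= kappa.
  by rewrite !mulr_ge0 ?invr_ge0 ?(ltW C0) ?(ltW Cs0) ?(ltW gC0) ?(ltW fC0).
pose weight (x : G) := rho (mdist (\val o) (\val x)).
have weight0 x : 0 <= weight x by rewrite rho_ge0 ?mdist_ge0.
pose cap x y := if x \in neighbours P y then kappa * weight x else 0.
have cap_ge0 x y : 0 <= cap x y by rewrite /cap; case: ifP => // _; exact: mulr_ge0.
have cap_le x y : cap x y <= kappa * weight x.
  by rewrite /cap; case: ifP => // _; exact: mulr_ge0.
have cap_nb x y : x \notin neighbours P y -> cap x y = 0.
  by rewrite /cap => /negbTE ->.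
have nb_sym (x y : G) : (x \in neighbours P y) = (y \in neighbours P x).
  by rewrite !mem_neighbours// metric_sym.
have isoperimetric B : uniq B -> (size B)%:R <=
    \sum_(y <- B) \sum_(x <- neighbours P y | x \notin B) cap x y.
  move=> uB; pose s := [seq \val a | a <- B].
  (* A point is listed once for each of its neighbours in [B], so that the sum over [Z] is the sum
     over the edges entering [B]. *)
  pose Z := [seq \val x | y <- B, x <- [seq x <- neighbours P y | x \notin B]].
  have sparse x : (count (fun a => (mdist x a < C)%R) s <= N C)%N.
    rewrite -size_filter; apply: (size_le_card point (GN x C C0)).
      by rewrite filter_uniq// map_inj_uniq//; exact: val_inj.
    move=> a; rewrite mem_filter => /andP[xa /mapP[b _ ab]].
    by split; [rewrite ab; exact: set_valP|rewrite ballEmdist].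
  have boundary x : (exists2 a, a \in s & mdist x a <= 2 * C) ->
      (forall a, a \in s -> C <= mdist x a) -> exists2 z, z \in Z & mdist x z < C.
    move=> [_ /mapP[a aB ->] xa] far; have [z xz] := near_G x.
    exists (\val z) => //; apply/allpairsPdep; exists a, z; split => //.
    rewrite mem_filter; apply/andP; split.
      apply/negP => zB; have := far (\val z); rewrite map_f// => /(_ isT).
      by rewrite leNgt xz.
    rewrite mem_neighbours//; have := metric_triangle (\val z) x (\val a).
    by rewrite (metric_sym (\val z) x) /P; lra.
  have := isoperimetric_cutoff X_mms C0 Cs0 K0 rho_ge0 rho_nd rho_shift
    (fun x => fg_ball x C C0) sob sparse boundary.
  rewrite size_map big_allpairs_dep/= => le_S.
  pose S := \sum_(y <- B) \sum_(x <- [seq x <- neighbours P y | x \notin B]) weight x.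
  suff -> : \sum_(y <- B) \sum_(x <- neighbours P y | x \notin B) cap x y =
      kappa * S.
    rewrite /kappa mulrAC ler_pdivlMr// mulrC; apply: le_trans le_S _.
    by rewrite -/S -!mulrA.
  rewrite /S mulr_sumr; apply: eq_bigr => y _.
  rewrite mulr_sumr big_filter [LHS]big_seq_cond [RHS]big_seq_cond.
  by apply: eq_bigr => x /andP[xy _]; rewrite /cap xy.
have [f [f_cap f_inflow]] := infinite_flow (@neighbours_uniq _ _ _ P) nb_sym
  cap_ge0 cap_nb isoperimetric.
(* The boundary of an alternating chain meets every edge in both orientations, hence the division by
   2. *)
pose h (a b : G) := (f a b - f b a) / 2.
have hP a b : P <= mdist (\val a) (\val b) -> h a b = 0.
  move=> Pab; have f0 u v : u \notin neighbours P v -> f u v = 0.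
    by move=> /cap_nb uv; apply/eqP; rewrite eq_le andbC -{2}uv.
  have nab : a \notin neighbours P b by rewrite mem_neighbours// -leNgt.
  by rewrite /h !f0 ?subrr ?mul0r// nb_sym.
pose b (x : {ffun 'I_2 -> G}) := h (x ord0) (x (lift ord0 ord0)).
have b_chain : chains rho o b.
  apply: (antisymmetric_chain (K := kappa) (P := P)) => //; first exact: ltW.
  - by move=> u v; rewrite /h -mulNr opprB.
  - move=> u v; rewrite /h mulrDr -/(weight u) -/(weight v).
    have /andP[? ?] := f_cap u v; have /andP[? ?] := f_cap v u.
    have := cap_le u v; have := cap_le v u; have := mulr_ge0 kappa0 (weight0 u).
    have := mulr_ge0 kappa0 (weight0 v).
    by rewrite ler_norml => *; apply/andP; split; lra.
  - by move=> u v /ltW/hP.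
apply: (fundamental_class_eq0 ulf b_chain); apply/funext => y.
rewrite (coarse_boundaryE ulf _ P0); last first.
  by move=> u v; rewrite /b edge0 edge1; exact: hP.
rewrite -(f_inflow (y ord0)); apply: eq_bigr => z _.
by rewrite /b !edge0 !edge1 /h; lra.
Qed.
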